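(* Let $d\ge 1$, $T>0$, and let ${\bf X}_1,{\bf X}_2$ be statistically independent $d$-dimensional real random vectors with characteristic functions $f_i({\bf t})=\mathbb E[e^{j{\bf t}^T{\bf X}_i}]$, $i=1,2$. Suppose ${\bf X}_1+{\bf X}_2$ and ${\bf X}_1-{\bf X}_2$ are $(\epsilon,T)$-dependent, and suppose there is a constant $p>0$ such that $|f_i({\bf t})|\ge p$ for all ${\bf t}\in\mathbb R^d$ with $\|{\bf t}\|\le T$ and $i=1,2$. Then, if $0<\epsilon\le p^4/[360d^2(d+1)]$, there exist mean vectors $\widehat{\bf m}_1,\widehat{\bf m}_2\in\mathbb R^d$ and a common symmetric positive semi-definite matrix $\widehat{\bf Q}$ such that, with the Gaussian characteristic functions $$\Phi_i({\bf t})=e^{{\bf t}^T\left(j\widehat{\bf m}_i-\frac12\widehat{\bf Q}\,{\bf t}\right)},\quad i=1,2,$$ we have for all $\|{\bf t}\|\le T/2$ and $i=1,2$ $$|f_i({\bf t})-\Phi_i({\bf t})|\le C(\epsilon)\,|\Phi_i({\bf t})|,\qquad C(\epsilon)=\frac{720d^2(d+1)}{p^4}\,\epsilon.$$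
   Context: $j=\sqrt{-1}$. For ${\bf x}\in\mathbb R^d$, $\|{\bf x}\|=\|{\bf x}\|_1=\sum_i|x_i|$. For random vectors ${\bf U}_1,{\bf U}_2$ (of possibly different dimensions) with joint characteristic function $f_{{\bf U}_1,{\bf U}_2}({\bf t}_1,{\bf t}_2)=\mathbb E[e^{j{\bf t}_1^T{\bf U}_1+j{\bf t}_2^T{\bf U}_2}]$ and marginal characteristic functions $f_{{\bf U}_1},f_{{\bf U}_2}$, and constants $\epsilon,T\ge0$: ${\bf U}_1,{\bf U}_2$ are called $(\epsilon,T)$-dependent if $\sup_{\|{\bf t}_1\|\le T,\|{\bf t}_2\|\le T}|f_{{\bf U}_1,{\bf U}_2}({\bf t}_1,{\bf t}_2)-f_{{\bf U}_1}({\bf t}_1)f_{{\bf U}_2}({\bf t}_2)|\le\epsilon$. *)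

(* Defs.v *)
From HB Require Import structures.
From mathcomp Require Import all_boot all_order all_algebra.
From mathcomp Require Import all_classical all_reals all_analysis.
From mathcomp Require Import complex.
Set Implicit Arguments.
Unset Strict Implicit.
Unset Printing Implicit Defensive.
Import Order.TTheory GRing.Theory Num.Theory.
Local Open Scope ring_scope.
Local Open Scope classical_set_scope.

(* Vectors of R^d are represented by d.-tuple R, which carries the product
   (= Borel) sigma-algebra in MathComp-Analysis (measure_tuple_display). *)

Section Defs.
Variable R : realType.

Definition vadd d (u v : d.-tuple R) : d.-tuple R :=
  [tuple tnth u i + tnth v i | i < d].
Definition vsub d (u v : d.-tuple R) : d.-tuple R :=
  [tuple tnth u i - tnth v i | i < d].

Definition dotv d (t x : d.-tuple R) : R := \sum_(i < d) tnth t i * tnth x i.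

Definition l1norm d (x : d.-tuple R) : R := \sum_(i < d) `|tnth x i|.

Definition qform d (Q : 'M[R]_d) (t : d.-tuple R) : R :=
  \sum_(i < d) \sum_(k < d) tnth t i * Q i k * tnth t k.

Definition sym_psd d (Q : 'M[R]_d) : Prop :=
  Q^T = Q /\ forall v : d.-tuple R, 0 <= qform Q v.

Definition cmod (z : R[i]) : R := Normc.normc z.

Definition cexpi (x : R) : R[i] := (cos x +i* sin x)%C.

Section Prob.
Context {dT : measure_display} {Omega : measurableType dT}.
Variable P : probability Omega R.

Definition Eexpi (Y : Omega -> R) : R[i] :=
  (fine ('E_P[fun w => cos (Y w)]) +i* fine ('E_P[fun w => sin (Y w)]))%C.

Definition charfun d (X : Omega -> d.-tuple R) (t : d.-tuple R) : R[i] :=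
  Eexpi (fun w => dotv t (X w)).

Definition jcharfun d1 d2 (U1 : Omega -> d1.-tuple R) (U2 : Omega -> d2.-tuple R)
  (t1 : d1.-tuple R) (t2 : d2.-tuple R) : R[i] :=
  Eexpi (fun w => dotv t1 (U1 w) + dotv t2 (U2 w)).

Definition eps_T_dependent d1 d2 (U1 : Omega -> d1.-tuple R)
  (U2 : Omega -> d2.-tuple R) (eps T : R) : Prop :=
  forall (t1 : d1.-tuple R) (t2 : d2.-tuple R),
    l1norm t1 <= T -> l1norm t2 <= T ->
    cmod (jcharfun U1 U2 t1 t2 - charfun U1 t1 * charfun U2 t2) <= eps.

Definition indep_vec d1 d2 (X1 : Omega -> d1.-tuple R) (X2 : Omega -> d2.-tuple R)
  : Prop :=
  forall (A : set (d1.-tuple R)) (B : set (d2.-tuple R)),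
    measurable A -> measurable B ->
    (P (X1 @^-1` A `&` X2 @^-1` B) = P (X1 @^-1` A) * P (X2 @^-1` B))%classic%E.

End Prob.

Definition gauss_cf d (m : d.-tuple R) (Q : 'M[R]_d) (t : d.-tuple R) : R[i] :=
  ((expR (- (qform Q t / 2)))%:C * cexpi (dotv t m))%C.

End Defs.

(* Main.v *)
(** With [e = eps / p^4], independence turns the hypothesis into
    [f1(s+t) f2(s-t) = f1(s) f2(s) f1(t) f2(-t) (1 + O(e))] on the l1-ball of
    radius [T].  Hence [u = - (ln|f1| + ln|f2|) / 2] satisfies the quadratic
    functional equation up to [O(e)], while the phases of [f1] and [f2] satisfy
    Cauchy's equation up to [O(e)].

    An odd, bounded, approximately additive function that is small at the
    points [r e_k] is small on the whole ball of radius [r]: on a line, a bound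
    [m] on [[0, r]] gives [m / 2] on [[0, r / 2]] by doubling, and then on
    [[r / 2, r]] by reflection.  Applied twice to the polarization of [u], this
    bounds the distance from [u] to a quadratic form; as [u >= 0], a small
    multiple of the identity makes that form positive semi-definite.

    For the phases no continuous logarithm is needed.  Near [0] they are small
    by continuity; the factorization at [(h, h)] and [(h, -h)] carries a small
    phase from radius [r] to [2 r] with twice the error, and subtracting the
    linear function that interpolates at the points [2 r e_k] brings the error
    back to [O(d e)], so finitely many doublings reach radius [T]. *)
Require Import Defs.
From HB Require Import structures.
From mathcomp Require Import all_boot all_order all_algebra.
From mathcomp Require Import all_classical all_reals all_analysis.
From mathcomp Require Import measurable_realfun complex ring lra.
Set Implicit Arguments.
Unset Strict Implicit.
Unset Printing Implicit Defensive.
Import Order.TTheory GRing.Theory Num.Theory.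
Import numFieldNormedType.Exports.
Local Open Scope ring_scope.
Local Open Scope classical_set_scope.

(** * Stability of additive and quadratic functions on an l1-ball *)

Section RowNorm.
Variables (R : realType) (d : nat).
Implicit Types (s t : 'rV[R]_d) (x : R).

Definition rnorm s : R := \sum_(k < d) `|s 0 k|.

Lemma rnorm_ge0 s : 0 <= rnorm s.
Proof. by apply: sumr_ge0. Qed.

Lemma rnorm0 : rnorm 0 = 0.
Proof. by apply: big1 => k _; rewrite mxE normr0. Qed.

Lemma rnormN s : rnorm (- s) = rnorm s.
Proof. by apply: eq_bigr => k _; rewrite mxE normrN. Qed.

Lemma rnormD s t : rnorm (s + t) <= rnorm s + rnorm t.
Proof.
by rewrite /rnorm -big_split /=; apply: ler_sum => k _; rewrite mxE ler_normD.
Qed.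

Lemma rnormB s t : rnorm (s - t) <= rnorm s + rnorm t.
Proof. by rewrite -[rnorm t]rnormN rnormD. Qed.

Lemma rnormZ x s : rnorm (x *: s) = `|x| * rnorm s.
Proof. by rewrite /rnorm mulr_sumr; apply: eq_bigr => k _; rewrite mxE normrM. Qed.

Lemma rnorm_delta k : rnorm (delta_mx 0 k) = 1.
Proof.
rewrite /rnorm (bigD1 k)//= big1 => [|i ik]; rewrite mxE eqxx ?eqxx ?normr1 ?addr0//=.
by rewrite (negbTE ik) normr0.
Qed.

Lemma coord_le_rnorm s k : `|s 0 k| <= rnorm s.
Proof. by rewrite /rnorm (bigD1 k)//= lerDl sumr_ge0. Qed.

End RowNorm.

(** * Approximately additive functions, on an interval and on an l1-ball *)

Section ApproxAdditive.
Variable R : realType.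

(** The bound [M] makes the supremum of [|a|] on [[0, r]] finite, so that a self-improving
    inequality can be solved for it; the outcome depends on [k] and [b] alone. *)
Lemma approx_additive1 (a : R -> R) (r b k M : R) : 0 <= r ->
  (forall x y, 0 <= x -> 0 <= y -> x + y <= r ->
     `|a (x + y) - a x - a y| <= b) ->
  `|a r| <= k -> (forall x, 0 <= x <= r -> `|a x| <= M) ->
  forall x, 0 <= x <= r -> `|a x| <= 2 * k + 3 * b.
Proof.
move=> r0 ab ak aM.
have b0 : 0 <= b.
  by apply: le_trans (ab 0 0 _ _ _); rewrite ?normr_ge0 ?addr0.
have k0 : 0 <= k by exact: le_trans ak.
(* [step] makes [sup |a| <= sup |a| / 2 + (3 b / 2 + k)]. *)
have step m : (forall x, 0 <= x <= r -> `|a x| <= m) ->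
    forall x, 0 <= x <= r -> `|a x| <= m / 2 + (3 * b / 2 + k).
  move=> am.
  (* Doubling: [2 * a x] equals [a (x + x)] up to [b]. *)
  have half x : 0 <= x -> x + x <= r -> `|a x| <= (m + b) / 2.
    move=> x0 xr; have := ab x x x0 x0 xr; have := am (x + x).
    have -> : 0 <= x + x <= r by apply/andP; split=> //; lra.
    by move=> /(_ isT); rewrite !ler_norml; lra.
  move=> x /andP[x0 xr]; have [h|h] := lerP (x + x) r.
    by apply: le_trans (half _ x0 h) _; lra.
  (* Reflection: [a x] is [a r - a (r - x)] up to [b], and [r - x] lies in the lower half. *)
  have := ab x (r - x) x0; rewrite subrKC subr_ge0 => /(_ xr (lexx _)).
  have := half (r - x); rewrite subr_ge0 => /(_ xr).
  have -> : r - x + (r - x) <= r by lra.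
  by move=> /(_ isT); move: ak; rewrite !ler_norml; lra.
pose E := [set `|a x| | x in [set x | 0 <= x <= r]].
have Ene : E !=set0 by exists `|a 0|, 0 => //=; rewrite lexx.
have Eub : has_sup E.
  by split => //; exists M => _ [x /= xr <-]; exact: aM.
have sE x : 0 <= x <= r -> `|a x| <= sup E.
  by move=> xr; apply: ub_le_sup; [exact: Eub.2|exists x].
have : sup E <= sup E / 2 + (3 * b / 2 + k).
  by apply: ge_sup => // _ [x /= xr <-]; exact: step.
move=> h x xr; apply: le_trans (sE x xr) _; lra.
Qed.

(** The point [s] is reached from 0 in [d] steps, one coordinate at a time. Each step costs
    [2 * k + 3 * b] for the value on the axis and [b] for additivity. *)
Lemma approx_additive d (a : 'rV[R]_d -> R) (r b k M : R) : 0 <= r ->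
  (forall s, a (- s) = - a s) ->
  (forall s t, rnorm s + rnorm t <= r -> `|a (s + t) - a s - a t| <= b) ->
  (forall i, `|a (r *: delta_mx 0 i)| <= k) ->
  (forall s, rnorm s <= r -> `|a s| <= M) ->
  forall s, rnorm s <= r -> `|a s| <= d%:R * (2 * k + 4 * b).
Proof.
move=> r0 aN ab ak aM s sr.
have a0 : a 0 = 0 by have := aN 0; rewrite oppr0; lra.
(* Oddness reduces the whole axis to its nonnegative half. *)
have line i (x : R) : `|x| <= r -> `|a (x *: delta_mx 0 i)| <= 2 * k + 3 * b.
  wlog x0 : x / 0 <= x.
    move=> wl xr; have [/wl/(_ xr)//|/ltW x0] := leP 0 x.
    by rewrite -normrN -aN -scaleNr; apply: wl; rewrite ?oppr_ge0 ?normrN.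
  rewrite ger0_norm // => xr.
  apply: (@approx_additive1 (fun x => a (x *: delta_mx 0 i)) r b k M) => //.
  - move=> y z y0 z0 yz; rewrite scalerDl.
    by apply: ab; rewrite !rnormZ rnorm_delta !mulr1 !ger0_norm.
  - move=> y /andP[y0 yr]; apply: aM.
    by rewrite rnormZ rnorm_delta mulr1 ger0_norm.
  - by rewrite x0.
pose w n : 'rV[R]_d := \row_i (if (i < n)%N then s 0 i else 0).
(* The two supports are disjoint, so the norms add up to at most [rnorm s] and every step stays
   where additivity is known. *)
have wr (i : 'I_d) : rnorm (w i) + rnorm (s 0 i *: delta_mx 0 i : 'rV_d) <= r.
  apply: le_trans sr; rewrite /rnorm -big_split /=; apply: ler_sum => j _.
  rewrite !mxE eqxx /=; have [->|ji] := eqVneq j i.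
    by rewrite ltnn normr0 add0r mulr1.
  by rewrite mulr0 normr0 addr0; case: ifP => // _; rewrite normr0.
have wS (i : 'I_d) : w i.+1 = w i + s 0 i *: delta_mx 0 i.
  apply/rowP => j; rewrite !mxE eqxx /= ltnS leq_eqVlt.
  have [->|ji] := eqVneq j i; first by rewrite eqxx ltnn /= add0r mulr1.
  by rewrite (negbTE (ji : (j : nat) != i)) mulr0 addr0.
have main n : (n <= d)%N -> `|a (w n)| <= n%:R * (2 * k + 4 * b).
  elim: n => [_|n IH nd].
    have -> : w 0%N = 0 by apply/rowP => j; rewrite !mxE.
    by rewrite a0 normr0 mul0r.
  have := IH (ltnW nd); have /= := wS (Ordinal nd).
  set i := Ordinal nd => wi; have := ab (w n) (s 0 i *: delta_mx 0 i) (wr i).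
  have si : `|s 0 i| <= r by apply: le_trans sr; exact: coord_le_rnorm.
  rewrite -wi.
  have := line i _ si; rewrite -[n.+1%:R]natr1 [(n%:R + 1) * _]mulrDl !ler_norml.
  move: (n%:R * _) => c; lra.
have <- : w d = s by apply/rowP => j; rewrite mxE ltn_ord.
exact: main.
Qed.

End ApproxAdditive.

(** * Bilinear forms and approximately quadratic functions *)

Section QuadraticStability.
Variables (R : realType) (d : nat).
Implicit Types (s t v : 'rV[R]_d) (Q : 'M[R]_d).

Definition tuple_of_row s : d.-tuple R := [tuple s 0 i | i < d].
Definition row_of_tuple (t : d.-tuple R) : 'rV[R]_d := \row_i tnth t i.

Lemma row_of_tupleK : cancel row_of_tuple tuple_of_row.
Proof. by move=> t; apply: eq_from_tnth => i; rewrite tnth_mktuple mxE. Qed.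

Definition bform Q s t : R := (s *m Q *m t^T) 0 0.

Lemma bformE Q s t : bform Q s t = \sum_i \sum_k s 0 i * Q i k * t 0 k.
Proof.
rewrite /bform mxE exchange_big /=; apply: eq_bigr => k _.
by rewrite !mxE mulr_suml.
Qed.

Lemma qform_row Q s : qform Q (tuple_of_row s) = bform Q s s.
Proof.
rewrite bformE; apply: eq_bigr => i _; apply: eq_bigr => k _.
by rewrite !tnth_mktuple.
Qed.

Lemma bformDl Q s s' t : bform Q (s + s') t = bform Q s t + bform Q s' t.
Proof. by rewrite /bform !mulmxDl mxE. Qed.

Lemma bformNl Q s t : bform Q (- s) t = - bform Q s t.
Proof. by rewrite /bform !mulNmx mxE. Qed.

Lemma bformZl Q x s t : bform Q (x *: s) t = x * bform Q s t.
Proof. by rewrite /bform -!scalemxAl mxE. Qed.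

Lemma bformC Q s t : Q^T = Q -> bform Q s t = bform Q t s.
Proof.
move=> Qs; rewrite /bform -[s *m Q *m _]trmxK mxE !trmx_mul trmxK Qs mulmxA.
by [].
Qed.

Lemma bform_delta Q i k : bform Q (delta_mx 0 i) (delta_mx 0 k) = Q i k.
Proof. by rewrite /bform -rowE trmx_delta -colE !mxE. Qed.

Lemma bform_bound Q r s t : 0 <= r -> rnorm s <= r -> rnorm t <= r ->
  `|bform Q s t| <= \sum_i \sum_k r * `|Q i k| * r.
Proof.
move=> r0 sr tr; rewrite bformE.
apply: le_trans (ler_norm_sum _ _ _) _; apply: ler_sum => i _.
apply: le_trans (ler_norm_sum _ _ _) _; apply: ler_sum => k _.
rewrite !normrM !ler_pM ?mulr_ge0//.
- exact: le_trans (coord_le_rnorm _ _) sr.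
- exact: le_trans (coord_le_rnorm _ _) tr.
Qed.

(** Cauchy-Schwarz between the l1 and l2 norms: [|v_i| |v_k| <= (v_i^2 + v_k^2) / 2], summed over
    all pairs. *)
Lemma sqr_rnorm_le v : rnorm v ^+ 2 <= d%:R * \sum_i v 0 i ^+ 2.
Proof.
have -> : d%:R * \sum_i v 0 i ^+ 2 =
    \sum_i \sum_k (v 0 i ^+ 2 + v 0 k ^+ 2) / 2.
  under [RHS]eq_bigr do rewrite -mulr_suml big_split /= sumr_const card_ord.
  rewrite -mulr_suml big_split /= sumr_const card_ord sumrMnl.
  by field.
rewrite expr2 {1}/rnorm mulr_suml; apply: ler_sum => i _.
rewrite mulr_sumr; apply: ler_sum => k _.
have := sqr_ge0 (`|v 0 i| - `|v 0 k|).
by rewrite sqrrB !real_normK ?num_real//; lra.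
Qed.

Lemma sum_sqr_le v : \sum_i v 0 i ^+ 2 <= rnorm v ^+ 2.
Proof.
rewrite expr2 {1}/rnorm mulr_suml; apply: ler_sum => i _.
by rewrite -[_ ^+ 2]ger0_norm ?sqr_ge0// normrX expr2 ler_wpM2l// coord_le_rnorm.
Qed.

(** [approx_additive] is used once in each variable. With the second argument frozen at an axis
    point it gives [d * (4 * b)], which then serves as the bound [k] for the other variable. *)
Lemma approx_biadditive (c : 'rV[R]_d -> 'rV[R]_d -> R) (r b M : R) : 0 <= r ->
  (forall s t, c s t = c t s) -> (forall s t, c (- s) t = - c s t) ->
  (forall s s' t, rnorm s <= r -> rnorm s' <= r -> rnorm t <= r ->
     `|c (s + s') t - c s t - c s' t| <= b) ->
  (forall i k, c (r *: delta_mx 0 i) (r *: delta_mx 0 k) = 0) ->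
  (forall s t, rnorm s <= r -> rnorm t <= r -> `|c s t| <= M) ->
  forall s t, rnorm s <= r -> rnorm t <= r ->
    `|c s t| <= d%:R * (2 * (d%:R * (4 * b)) + 4 * b).
Proof.
move=> r0 cC cN cb c0 cM s t sr tr.
have er k : rnorm (r *: delta_mx 0 k : 'rV[R]_d) <= r.
  by rewrite rnormZ rnorm_delta mulr1 ger0_norm.
apply: (approx_additive (a := c s) (M := M)) tr => //.
- by move=> t'; rewrite cC cN cC.
- move=> t1 t2 t12; have := rnorm_ge0 t1; have := rnorm_ge0 t2 => t20 t10.
  by rewrite ![c s _]cC; apply: cb => //; lra.
- move=> k; have := @approx_additive _ _ (c^~ (r *: delta_mx 0 k)) r b 0 M r0.
  rewrite mulr0 add0r; apply => //.
  + move=> s1 s2 s12; have := rnorm_ge0 s1; have := rnorm_ge0 s2 => s20 s10.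
    by apply: cb => //; lra.
  + by move=> i; rewrite c0 normr0.
  + by move=> s' s'r; apply: cM.
- by move=> t' t'r; apply: cM.
Qed.

(** The polarization [b] of [u] is biadditive up to [e / 2] on the half ball, where [s + t] and
    [s - t] stay within radius [T]. It is compared with the bilinear form that agrees with it at the
    axis points, and [u] is recovered on the diagonal. *)
Lemma approx_quadratic (u : 'rV[R]_d -> R) (T e M : R) : 0 < T ->
  u 0 = 0 -> (forall t, u (- t) = u t) ->
  (forall t, rnorm t <= T -> 0 <= u t <= M) ->
  (forall s t, rnorm s <= T -> rnorm t <= T ->
     `|u (s + t) + u (s - t) - 2 * u s - 2 * u t| <= e) ->
  exists Q, Q^T = Q /\
    forall t, rnorm t <= T -> `|u t - bform Q t t| <= 24 * d%:R ^+ 2 * e.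
Proof.
move=> T0 u0 uN uM ue; pose r := T / 2.
have r0 : 0 < r by rewrite /r; lra.
have rr : r + r = T by rewrite /r; lra.
have e0 : 0 <= e by apply: le_trans (ue 0 0 _ _); rewrite ?normr_ge0 ?rnorm0 ?ltW.
pose b s t := (u (s + t) - u (s - t)) / 4.
have bC s t : b s t = b t s.
  by rewrite /b [s + t]addrC -[s - t]opprB uN.
have bN s t : b (- s) t = - b s t.
  by rewrite /b -opprD uN [- s + t]addrC -[t - s]opprB uN; lra.
have rD s t : rnorm s <= r -> rnorm t <= r -> rnorm (s + t) <= T.
  by have := rnormD s t; lra.
have rB s t : rnorm s <= r -> rnorm t <= r -> rnorm (s - t) <= T.
  by have := rnormB s t; lra.
have bD s s' t : rnorm s <= r -> rnorm s' <= r -> rnorm t <= r ->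
    `|b (s + s') t - b s t - b s' t| <= e / 2.
  move=> sr s'r tr.
  have le_rT v : rnorm v <= r -> rnorm v <= T by lra.
  (* Four parallelogram relations, at [(s + t, s')], [(s - t, s')], [(s' + t, s)] and [(s' - t, s)].
     In their alternating combination the other terms cancel by evenness of [u], which leaves eight
     times the defect of [b], bounded by [4 * e]. *)
  have := ue _ _ (rD _ _ sr tr) (le_rT _ s'r).
  have := ue _ _ (rB _ _ sr tr) (le_rT _ s'r).
  have := ue _ _ (rD _ _ s'r tr) (le_rT _ sr).
  have := ue _ _ (rB _ _ s'r tr) (le_rT _ sr).
  rewrite /b [s' - t + s]addrC [s' + t + s]addrC !addrA.
  rewrite [s - t + s']addrAC [s + t + s']addrAC.
  have -> : u (s' - t - s) = u (s + t - s').
    by rewrite -uN; congr (u _); apply/rowP => i; rewrite !mxE; lra.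
  have -> : u (s' + t - s) = u (s - t - s').
    by rewrite -uN; congr (u _); apply/rowP => i; rewrite !mxE; lra.
  by rewrite !ler_norml; lra.
(* Chosen so that [bform Q] agrees with [b] at all pairs of points [r e_i], [r e_k]. *)
pose Q := (r ^+ 2)^-1 *: \matrix_(i, k) b (r *: delta_mx 0 i) (r *: delta_mx 0 k).
have Qs : Q^T = Q.
  by apply/matrixP => i k; rewrite !mxE bC.
exists Q; split => // t tT.
pose c s t := b s t - bform Q s t.
have cr s' t' : rnorm s' <= r -> rnorm t' <= r ->
    `|c s' t'| <= d%:R * (2 * (d%:R * (4 * (e / 2))) + 4 * (e / 2)).
  apply: (@approx_biadditive c r (e / 2)
    (M / 4 + \sum_i \sum_k r * `|Q i k| * r) (ltW r0)) => //.
  - by move=> x y; rewrite /c bC (bformC _ _ Qs).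
  - by move=> x y; rewrite /c bN bformNl; lra.
  - move=> x x' y xr x'r yr; have := bD x x' y xr x'r yr.
    by rewrite /c bformDl; congr (`| _ | <= _); ring.
  - move=> i k; rewrite /c bformZl (bformC _ _ Qs) bformZl bform_delta !mxE bC.
    by field; rewrite gt_eqF.
  - move=> x y xr yr; apply: le_trans (ler_normB _ _) (lerD _ _).
      have := uM _ (rD _ _ xr yr); have := uM _ (rB _ _ xr yr).
      by rewrite /b ler_norml; lra.
    exact: bform_bound (ltW r0) _ _.
(* At [s = t / 2] in both arguments, [c] is a quarter of [u t - bform Q t t]. *)
have : rnorm (2^-1 *: t) <= r.
  by rewrite rnormZ gtr0_norm ?invr_gt0// mulrC /r ler_wpM2r// invr_ge0.
move=> /[dup] /cr /[apply].
rewrite /c /b subrr u0 bformZl (bformC _ _ Qs) bformZl -scalerDl.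
have -> : 2^-1 + 2^-1 = 1 :> R by lra.
rewrite scale1r subr0.
have : d%:R * e <= d%:R ^+ 2 * e.
  rewrite ler_wpM2r// -natrX ler_nat -mulnn; case: (d) => // n.
  by rewrite leq_pmulr.
rewrite !ler_norml; move: (bform _ _ _) => q; move: (u t) => ut.
have -> : d%:R * (2 * (d%:R * (4 * (e / 2))) + 4 * (e / 2)) =
  4 * (d%:R ^+ 2 * e) + 2 * (d%:R * e) :> R by field.
rewrite -[24 * _ * e]mulrA; lra.
Qed.

Lemma bform_diag Q x s :
  bform (Q + x%:M) s s = bform Q s s + x * \sum_i s 0 i ^+ 2.
Proof.
rewrite /bform mulmxDr mulmxDl mxE; congr (_ + _).
rewrite mul_mx_scalar -scalemxAl mxE mxE; congr (_ * _).
by apply: eq_bigr => i _; rewrite mxE expr2.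
Qed.

(** As [u >= 0], the form of [Q] is at least [- e] on the ball, hence by homogeneity at least
    [- e * rnorm v ^+ 2 / T ^+ 2] everywhere. A multiple of the identity compensates this, at a cost
    of at most [e * d / 4] on the half ball. *)
Lemma approx_psd (u : 'rV[R]_d -> R) Q (T e : R) : 0 < T -> Q^T = Q ->
  (forall t, rnorm t <= T -> 0 <= u t) ->
  (forall t, rnorm t <= T -> `|u t - bform Q t t| <= e) ->
  exists Q', sym_psd Q' /\ forall t, rnorm t <= T / 2 ->
    `|u t - qform Q' (tuple_of_row t) / 2| <= e * (1 + d%:R / 4).
Proof.
move=> T0 Qs u0 uQ.
have e0 : 0 <= e by apply: le_trans (uQ 0 _); rewrite ?normr_ge0 ?rnorm0 ?ltW.
(* The factor [d] pays for replacing the squared l1-norm by the sum of squares. *)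
pose l := e * d%:R / T ^+ 2.
have l0 : 0 <= l by rewrite !mulr_ge0// invr_ge0 sqr_ge0.
have qE s : qform (2 *: (Q + l%:M)) (tuple_of_row s) / 2 =
    bform Q s s + l * \sum_i s 0 i ^+ 2.
  rewrite -bform_diag qform_row /bform -scalemxAr -scalemxAl mxE.
  by rewrite mulrAC divff ?mul1r.
(* The factor 2 cancels the one half in the Gaussian exponent. *)
exists (2 *: (Q + l%:M)); split; first split.
- by rewrite linearZ linearD /= Qs tr_scalar_mx.
- move=> v; rewrite -[v]row_of_tupleK; move: (row_of_tuple v) => {}v.
  rewrite -(pmulr_lge0 (x := 2^-1)) ?invr_gt0// qE.
  have [v0|] := eqVneq (rnorm v) 0.
    suff -> : v = 0.
      rewrite /bform !mul0mx mxE add0r mulr_ge0// sumr_ge0// => i _.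
      exact: sqr_ge0.
    apply/rowP => i; rewrite mxE; apply/eqP; rewrite -normr_le0 -v0.
    exact: coord_le_rnorm.
  move=> vn0; have n0 : 0 < rnorm v by rewrite lt_neqAle eq_sym vn0 rnorm_ge0.
  (* Rescaling [v] to norm [T] brings it to where the hypotheses on [u] apply. *)
  pose w := (T / rnorm v) *: v.
  have wT : rnorm w <= T.
    by rewrite rnormZ ger0_norm ?divr_ge0 ?(ltW T0) ?rnorm_ge0// divfK.
  have := uQ w wT; have := u0 w wT.
  rewrite /w bformZl (bformC _ _ Qs) bformZl => u0w.
  rewrite ler_norml => /andP[_ h].
  have {u0w h} : - e <= T / rnorm v * (T / rnorm v * bform Q v v) by lra.
  have Tn0 : T != 0 by rewrite gt_eqF.
  move=> /(ler_wpM2l (sqr_ge0 (rnorm v / T))).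
  have -> : (rnorm v / T) ^+ 2 * (T / rnorm v * (T / rnorm v * bform Q v v))
    = bform Q v v by field; rewrite vn0 Tn0.
  have := ler_wpM2l (divr_ge0 e0 (sqr_ge0 T)) (sqr_rnorm_le v).
  have -> : l * \sum_i v 0 i ^+ 2 = e / T ^+ 2 * (d%:R * \sum_i v 0 i ^+ 2).
    by rewrite /l; field.
  have -> : (rnorm v / T) ^+ 2 * - e = - (e / T ^+ 2 * rnorm v ^+ 2) by field.
  lra.
- move=> t tT; have tT' : rnorm t <= T by lra.
  have := uQ t tT'; rewrite qE.
  have : l * \sum_i t 0 i ^+ 2 <= e * (d%:R / 4).
    rewrite /l -!mulrA ler_wpM2l// ler_wpM2l// mulrC ler_pdivrMr ?exprn_gt0//.
    apply: le_trans (sum_sqr_le _) _.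
    have -> : 4^-1 * T ^+ 2 = (T / 2) ^+ 2 by field.
    by rewrite ler_sqr ?nnegrE ?rnorm_ge0//; lra.
  have : 0 <= l * \sum_i t 0 i ^+ 2.
    by rewrite mulr_ge0// sumr_ge0// => i _; exact: sqr_ge0.
  rewrite !ler_norml mulrDr mulr1; lra.
Qed.

End QuadraticStability.

(** * Polar coordinates in R[i] *)

Section Trigonometry.
Variable R : realType.
Implicit Types (x y a e : R) (z w : R[i]).

Lemma mvt_from0 (f df : R -> R) x : (forall y, is_derive y 1 f (df y)) ->
  0 < x -> exists2 c : R, 0 < c < x & f x - f 0 = df c * x.
Proof.
move=> fdf x0; have fc : {within `[0, x], continuous f}.
  by apply: derivable_within_continuous => y _; case: (fdf y).
have [c cx ->] := MVT x0 (fun y _ => fdf y) fc.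
by exists c; rewrite ?subr0 //; move: cx; rewrite in_itv.
Qed.

Lemma norm_sin_le x : `|sin x| <= `|x|.
Proof.
wlog x0 : x / 0 < x.
  move=> wl; case: (ltgtP x 0) => [x0|/wl//|->]; last by rewrite sin0.
  by rewrite -normrN -sinN -[`|x|]normrN wl// oppr_gt0.
have [c _] := mvt_from0 (@is_derive_sin R) x0.
rewrite sin0 subr0 => ->; rewrite normrM.
by rewrite -[leRHS]mul1r ler_wpM2r// cos_max.
Qed.

(** From [cos x = 1 - 2 sin^2 (x / 2)] and [|sin (x / 2)| <= |x / 2|]. *)
Lemma cos_ge x : 1 - x ^+ 2 / 2 <= cos x.
Proof.
have := norm_sin_le (x / 2); rewrite -ler_sqr ?nnegrE// !real_normK ?num_real// sin2cos2.
have {4}-> : x = x / 2 *+ 2 by rewrite -mulr_natr divfK.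
by rewrite cos_mulr2n; lra.
Qed.

(** By the mean value theorem, since [cos >= 1 / 2] on [[0, 1]]. *)
Lemma norm_le_2sin x : `|x| <= 1 -> `|x| <= 2 * `|sin x|.
Proof.
wlog x0 : x / 0 < x.
  move=> wl; case: (ltgtP x 0) => [x0|/wl//|->]; last by rewrite sin0 normr0 mulr0.
  by rewrite -normrN -[`|sin x|]normrN -sinN; apply: wl; rewrite oppr_gt0.
have [c /andP[c0 cx]] := mvt_from0 (@is_derive_sin R) x0.
rewrite sin0 subr0 => ->; rewrite normrM mulrA (gtr0_norm x0) => x1.
have := cos_ge c; have : c ^+ 2 <= 1 by nra.
move=> c2 cc; have c12 : 1 / 2 <= cos c by lra.
by rewrite ger0_norm; [nra|lra].
Qed.

Lemma norm_atan_le x : `|atan x| <= `|x|.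
Proof.
wlog x0 : x / 0 < x.
  move=> wl; case: (ltgtP x 0) => [x0|/wl//|->]; last by rewrite atan0.
  by rewrite -normrN -atanN -[`|x|]normrN wl// oppr_gt0.
have [c _] := mvt_from0 (@is_derive1_atan R) x0.
rewrite atan0 subr0 => ->; rewrite normrM.
have c1 : 1 <= 1 + c ^+ 2 by rewrite lerDl sqr_ge0.
rewrite -[leRHS]mul1r ler_wpM2r// ger0_norm ?invr_ge0 ?(le_trans ler01)//.
by rewrite invf_le1 ?(lt_le_trans ltr01).
Qed.

(** The inequality [ln y <= y - 1] at [y = x] gives the upper bound and at [y = x^-1] the lower
    one. *)
Lemma norm_ln_le x e : e <= 1 / 2 -> `|x - 1| <= e -> `|ln x| <= 2 * e.
Proof.
move=> e2; rewrite ler_norml => /andP[x1 x2].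
have x0 : 0 < x by lra.
have := @le_ln1Dx R (x - 1); rewrite subrKC => /(_ _)/=.
have -> : -1 < x - 1 by lra.
move=> /(_ isT) lnx.
have := @le_ln1Dx R (x^-1 - 1); rewrite subrKC lnV ?posrE//.
have xV : x^-1 * x = 1 by rewrite mulVf ?gt_eqF.
have xV0 : 0 < x^-1 by rewrite invr_gt0.
have -> : -1 < x^-1 - 1 by lra.
move=> /(_ isT) lnxV.
have : x^-1 - 1 <= 2 * e by nra.
rewrite ler_norml; lra.
Qed.

Lemma norm_expR_sub1_le x : `|x| <= 1 / 2 -> `|expR x - 1| <= 2 * `|x|.
Proof.
move=> x2; have := expR_ge1Dx x; have := expR_ge1Dx (- x).
have := expRxMexpNx_1 x; have := expR_gt0 x; have := expR_gt0 (- x).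
move: (expR x) (expR (- x)) => E F.
have := ler_norm x; have := ler_norm (- x); rewrite normrN.
move: (`|x|) x2 => n *.
have : E - 1 <= 2 * n by nra.
rewrite ler_norml; lra.
Qed.

(** * The modulus, the unit circle and angles of complex numbers near 1 *)

Lemma cmodM z w : cmod (z * w) = cmod z * cmod w.
Proof. exact: Normc.normcM. Qed.

Lemma cmodD z w : cmod (z + w) <= cmod z + cmod w.
Proof. exact: le_normcD. Qed.

Lemma cmodN z : cmod (- z) = cmod z.
Proof. exact: normcN. Qed.

Lemma cmod_ge0 z : 0 <= cmod z.
Proof. by case: z => a b; exact: sqrtr_ge0. Qed.

Lemma cmod0_eq0 z : cmod z = 0 -> z = 0.
Proof. exact: Normc.eq0_normc. Qed.

Lemma cmodV z : cmod z^-1 = (cmod z)^-1.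
Proof. exact: Normc.normcV. Qed.

Lemma cmodR x : cmod x%:C%C = `|x|.
Proof. by rewrite /cmod /= expr0n addr0 sqrtr_sqr. Qed.

Lemma cmod1 : cmod (1 : R[i]) = 1.
Proof. exact: Normc.normc1. Qed.

Lemma cmodJ z : cmod z^*%C = cmod z.
Proof. by case: z => a b; rewrite /cmod /= sqrrN. Qed.

Lemma cmod_sub_ge z w : `|cmod z - cmod w| <= cmod (z - w).
Proof.
have := cmodD (z - w) w; have := cmodD (w - z) z.
by rewrite !subrK -opprB cmodN ler_norml; lra.
Qed.

Lemma cmod_Re z : `|complex.Re z| <= cmod z.
Proof.
case: z => a b; rewrite /cmod /= -sqrtr_sqr ler_sqrt ?addr_ge0 ?sqr_ge0//.
by rewrite lerDl sqr_ge0.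
Qed.

Lemma cmod_Im z : `|complex.Im z| <= cmod z.
Proof.
case: z => a b; rewrite /cmod /= -sqrtr_sqr ler_sqrt ?addr_ge0 ?sqr_ge0//.
by rewrite lerDr sqr_ge0.
Qed.

Lemma cexpiD x y : cexpi (x + y) = cexpi x * cexpi y.
Proof.
by rewrite /cexpi cosD sinD; apply/eqP; rewrite eq_complex /= eqxx/= addrC.
Qed.

Lemma cexpiN x : cexpi (- x) = (cexpi x)^*%C.
Proof. by rewrite /cexpi cosN sinN. Qed.

Lemma cmod_cexpi x : cmod (cexpi x) = 1.
Proof. by rewrite /cmod /= cos2Dsin2 sqrtr1. Qed.

Lemma cexpi_neq0 x : cexpi x != 0.
Proof.
apply/eqP => h; have := cmod_cexpi x; rewrite h /cmod Normc.normc0 => /eqP.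
by rewrite eq_sym oner_eq0.
Qed.

Lemma cmod_cexpi_sub1_le x : cmod (cexpi x - 1) <= `|x|.
Proof.
have -> : cexpi x - 1 = ((cos x - 1) +i* sin x)%C.
  by apply/eqP; rewrite eq_complex /= subr0 !eqxx.
rewrite /cmod /= -sqrtr_sqr ler_sqrt ?sqr_ge0//.
have := cos_ge x; have := cos2Dsin2 x; rewrite sqrrB; lra.
Qed.

(** The real part of [z] is at least [1 / 2], so [atan (y / x)] is an angle of [z], of size at most
    [|y| / x <= 2 * e]. *)
Lemma polar_near1 z e : e <= 1 / 2 -> cmod (z - 1) <= e ->
  exists2 a, `|a| <= 2 * e & z = (cmod z)%:C%C * cexpi a.
Proof.
case: z => x y e2 ze.
have ye : `|y| <= e by have := le_trans (cmod_Im _) ze; rewrite /= subr0.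
have /andP[xe _] : - e <= x - 1 <= e.
  by rewrite -ler_norml; exact: le_trans (cmod_Re _) ze.
have x0 : 0 < x by lra.
exists (atan (y / x)).
  apply: le_trans (norm_atan_le _) _.
  rewrite normrM normfV (gtr0_norm x0) ler_pdivrMr//.
  have e0 : 0 <= e by exact: le_trans ye.
  have : 0 <= e * (x - 1 / 2) by rewrite mulr_ge0//; lra.
  lra.
have -> : cmod (x +i* y)%C = x * Num.sqrt (1 + (y / x) ^+ 2).
  rewrite -{2}(gtr0_norm x0) -sqrtr_sqr -sqrtrM ?sqr_ge0// /cmod /=.
  by congr Num.sqrt; field; rewrite gt_eqF.
set q := Num.sqrt _.
have q0 : q != 0 by rewrite gt_eqF// sqrtr_gt0 ltr_pwDl// sqr_ge0.
have cq : cos (atan (y / x)) = q^-1 by exact: cos_atan.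
have sq : sin (atan (y / x)) = y / x / q.
  rewrite -[y / x in RHS]atanK /tan cq invrK mulfK//.
apply/eqP; rewrite eq_complex /= cq sq; apply/andP; split; apply/eqP; field.
  by rewrite q0 gt_eqF.
by rewrite q0 gt_eqF.
Qed.

(** Converts a multiplicative error into additive errors of log-modulus and phase. The a priori
    bound [|x| <= 1] excludes the neighbourhoods of the other zeros of [sin]. *)
Lemma small_angle r x e : e <= 1 / 10 -> `|x| <= 1 ->
  cmod (r%:C%C * cexpi x - 1) <= e -> `|ln `|r| | <= 2 * e /\ `|x| <= 3 * e.
Proof.
move=> e1 x1 he.
have r1 : `| `|r| - 1| <= e.
  apply: le_trans he; apply: le_trans (cmod_sub_ge _ _).
  by rewrite cmodM cmodR cmod_cexpi mulr1 cmod1.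
split; first by apply: norm_ln_le => //; lra.
have : `|r| * `|sin x| <= e.
  apply: le_trans he; rewrite -normrM; apply: le_trans (cmod_Im _).
  by rewrite /= mul0r addr0 subr0.
have := norm_le_2sin x1; move: r1; rewrite ler_norml => /andP[r1 r2].
move: (`|sin x|) (normr_ge0 (sin x)) (`|x|) => s s0 n *; nra.
Qed.

Lemma cmod_exp_sub1_le x y e : `|x| + `|y| <= e -> e <= 1 / 2 ->
  cmod ((expR x)%:C%C * cexpi y - 1) <= 2 * e.
Proof.
move=> xye e2; have := normr_ge0 x; have := normr_ge0 y => y0 x0.
have -> : (expR x)%:C%C * cexpi y - 1 =
  (expR x)%:C%C * (cexpi y - 1) + (expR x - 1)%:C%C.
  by rewrite rmorphB /= mulrBr mulr1 addrA subrK.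
apply: le_trans (cmodD _ _) _; rewrite cmodM !cmodR ger0_norm ?expR_ge0//.
have := cmod_cexpi_sub1_le y; have := @norm_expR_sub1_le x.
have -> : `|x| <= 1 / 2 by lra.
move=> /(_ isT) h; have := h; rewrite {1}ler_norml => /andP[_ h2].
have := cmod_ge0 (cexpi y - 1); have := expR_ge0 x.
move: (cmod _) (expR x) h h2 => c E *; nra.
Qed.

End Trigonometry.

(** * Approximate factorization *)

Section ApproxFactorization.
Variables (R : realType) (d : nat).
Implicit Types (s t m : 'rV[R]_d) (F : 'rV[R]_d -> R[i]).

Definition rdot m t : R := \sum_k t 0 k * m 0 k.

Lemma rdotDr m s t : rdot m (s + t) = rdot m s + rdot m t.
Proof. by rewrite -big_split; apply: eq_bigr => k _; rewrite mxE mulrDl. Qed.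

Lemma rdotDl m m' t : rdot (m + m') t = rdot m t + rdot m' t.
Proof. by rewrite -big_split; apply: eq_bigr => k _; rewrite mxE mulrDr. Qed.

Lemma rdotNr m t : rdot m (- t) = - rdot m t.
Proof. by rewrite -sumrN; apply: eq_bigr => k _; rewrite mxE mulNr. Qed.

Lemma rdotZr m x t : rdot m (x *: t) = x * rdot m t.
Proof. by rewrite mulr_sumr; apply: eq_bigr => k _; rewrite mxE mulrA. Qed.

Lemma rdot_delta m k : rdot m (delta_mx 0 k) = m 0 k.
Proof.
rewrite /rdot (bigD1 k)//= mxE !eqxx mul1r big1 ?addr0// => i ik.
by rewrite mxE (negbTE ik) andbF mul0r.
Qed.

Lemma rdot0l t : rdot 0 t = 0.
Proof. by apply: big1 => k _; rewrite mxE mulr0. Qed.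

Lemma norm_rdot_le m t c : (forall k, `|m 0 k| <= c) -> `|rdot m t| <= c * rnorm t.
Proof.
move=> mc; apply: le_trans (ler_norm_sum _ _ _) _; rewrite mulr_sumr.
by apply: ler_sum => k _; rewrite normrM mulrC ler_wpM2r.
Qed.

(** On the ball of radius [r], some argument of [F] lies within [c] of the linear function [rdot m].
    The angle is existential at each point, so no continuous branch of the argument has to be
    constructed. *)
Definition phase_near F m (r c : R) := forall t, rnorm t <= r ->
  exists2 a, `|a| <= c & F t = (cmod (F t))%:C%C * cexpi (a + rdot m t).

Lemma polarM (x y a b : R) : (x%:C%C * cexpi a) * (y%:C%C * cexpi b) =
  (x * y)%:C%C * cexpi (a + b).
Proof. by rewrite cexpiD rmorphM /=; ring. Qed.

Lemma polarJ (x a : R) : (x%:C%C * cexpi a)^*%C = x%:C%C * cexpi (- a).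
Proof. by rewrite rmorphM /= cexpiN; congr (_ * _); rewrite oppr0. Qed.

Lemma polar_quot z (x y a b : R) : y != 0 ->
  x%:C%C * cexpi a = z * (y%:C%C * cexpi b) ->
  z = (x / y)%:C%C * cexpi (a - b).
Proof.
move=> y0 h; have yb0 : y%:C%C * cexpi b != 0.
  by rewrite mulf_neq0 ?cexpi_neq0// eq_complex /= eqxx andbT.
by apply: (mulIf yb0); rewrite polarM divfK// subrK.
Qed.

(** Any choice of small angles is odd on the ball: Hermitian symmetry of [F] makes the sum of the
    angles at [t] and [- t] a zero of [sin], and its size is at most [2 * c <= 1]. *)
Lemma odd_angle F m r c : c <= 1 / 2 ->
  (forall t, F (- t) = (F t)^*%C) -> (forall t, rnorm t <= r -> F t != 0) ->
  phase_near F m r c ->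
  exists a : 'rV[R]_d -> R, (forall t, a (- t) = - a t) /\
    forall t, rnorm t <= r ->
      `|a t| <= c /\ F t = (cmod (F t))%:C%C * cexpi (a t + rdot m t).
Proof.
move=> c2 FN F0 Fm.
have /choice[a0 a0P] t : exists a, rnorm t <= r ->
    `|a| <= c /\ F t = (cmod (F t))%:C%C * cexpi (a + rdot m t).
  have [/Fm[a ac aF]|] := boolP (rnorm t <= r); first by exists a.
  by move=> _; exists 0.
(* The value 0 outside the ball makes the function odd everywhere. *)
exists (fun t => if rnorm t <= r then a0 t else 0); split=> [t|t tr]; last first.
  by rewrite tr; exact: a0P.
rewrite rnormN; case: ifPn => [tr|_]; last by rewrite oppr0.
have tr' : rnorm (- t) <= r by rewrite rnormN.
have [a1 F1] := a0P _ tr; have [a2] := a0P _ tr'.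
rewrite FN {1}F1 cmodJ polarJ rdotNr -[RHS]mul1r => /polar_quot.
have cF : cmod (F t) != 0 by apply: contra_neq (F0 _ tr); exact: cmod0_eq0.
move=> /(_ cF); rewrite divff// rmorph1 mul1r => /(congr1 (@complex.Im R)).
set b := (X in cexpi X); rewrite /= => /esym sb0.
have bE : b = - (a0 (- t) + a0 t) by rewrite /b; ring.
have : `|b| <= 2 * `|sin b|.
  apply: norm_le_2sin; rewrite bE normrN; apply: le_trans (ler_normD _ _) _; lra.
by rewrite sb0 normr0 mulr0 normr_le0 bE oppr_eq0 addr_eq0 => /eqP.
Qed.

(** * Phases and moduli of two functions that satisfy the approximate factorization *)

Variables (F1 F2 : 'rV[R]_d -> R[i]) (T e : R).
Hypothesis d0 : (0 < d)%N.
Hypothesis e0 : 0 < e.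
Hypothesis e_small : 360 * d%:R ^+ 2 * (d%:R + 1) * e <= 1.
Hypothesis F10 : F1 0 = 1.
Hypothesis F20 : F2 0 = 1.
Hypothesis F1N : forall t, F1 (- t) = (F1 t)^*%C.
Hypothesis F2N : forall t, F2 (- t) = (F2 t)^*%C.
Hypothesis F1_neq0 : forall t, rnorm t <= T -> F1 t != 0.
Hypothesis F2_neq0 : forall t, rnorm t <= T -> F2 t != 0.
Hypothesis F_near : forall s t, rnorm s <= T -> rnorm t <= T ->
  exists2 z, cmod (z - 1) <= e &
    F1 (s + t) * F2 (s - t) = z * (F1 s * F2 s * (F1 t * (F2 t)^*%C)).

Let d1 : 1 <= d%:R :> R. Proof. by rewrite ler1n. Qed.

Lemma e_small_linear : 360 * d%:R * e <= 1.
Proof.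
apply: le_trans e_small; rewrite ler_wpM2r ?ltW//.
by have := d1; move: (d%:R : R) => D *; nra.
Qed.

Lemma e_le10 : e <= 1 / 10.
Proof. have := e_small_linear; have := d1; have := e0; nra. Qed.

(** The linear parts cancel in the factorization. The condition [6 * c <= 1] keeps the combination
    of six angles below 1, as [small_angle] requires. *)
Lemma angles_near (a1 a2 : 'rV[R]_d -> R) m1 m2 r c s t : r <= T -> 6 * c <= 1 ->
  (forall t, rnorm t <= r ->
    `|a1 t| <= c /\ F1 t = (cmod (F1 t))%:C%C * cexpi (a1 t + rdot m1 t)) ->
  (forall t, rnorm t <= r ->
    `|a2 t| <= c /\ F2 t = (cmod (F2 t))%:C%C * cexpi (a2 t + rdot m2 t)) ->
  rnorm s + rnorm t <= r ->
  `|a1 (s + t) + a2 (s - t) - a1 s - a2 s - a1 t + a2 t| <= 3 * e.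
Proof.
move=> rT c6 a1P a2P st.
have s0 := rnorm_ge0 s; have t0 := rnorm_ge0 t.
have sr : rnorm s <= r by lra.
have tr : rnorm t <= r by lra.
have [ap Fp] := a1P _ (le_trans (rnormD _ _) st).
have [am Fm] := a2P _ (le_trans (rnormB _ _) st).
have [as1 Fs1] := a1P _ sr; have [as2 Fs2] := a2P _ sr.
have [at1 Ft1] := a1P _ tr; have [at2 Ft2] := a2P _ tr.
have [z z1] := F_near (le_trans sr rT) (le_trans tr rT).
rewrite Fp Fm Fs1 Fs2 Ft1 Ft2 polarJ !polarM => /polar_quot.
have nz F x : F x != 0 -> cmod (F x) != 0.
  by apply: contra_neq; exact: cmod0_eq0.
rewrite !mulf_neq0 ?nz ?F1_neq0 ?F2_neq0 ?(le_trans _ rT)// => /(_ isT) zE.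
move: z1; rewrite zE => /small_angle; case.
- exact: e_le10.
- rewrite !rdotDr rdotNr.
  set w := (X in `|X|); have -> : w =
    a1 (s + t) + a2 (s - t) - a1 s - a2 s - a1 t + a2 t by rewrite /w; ring.
  by move: ap am as1 as2 at1 at2; rewrite !ler_norml; lra.
- rewrite !rdotDr rdotNr => _; congr (`| _ | <= _); ring.
Qed.

(** Restores the phase error to [12 * d * e], whatever the [c] at the start; this keeps the error
    from growing under repeated doubling. *)
Lemma recentre m1 m2 r c : 0 < r -> r <= T -> 6 * c <= 1 ->
  phase_near F1 m1 r c -> phase_near F2 m2 r c ->
  exists m1' m2', phase_near F1 m1' r (12 * d%:R * e) /\
                  phase_near F2 m2' r (12 * d%:R * e).
Proof.
move=> r0 rT c6 P1 P2.
have c2 : c <= 1 / 2 by lra.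
have ne1 t : rnorm t <= r -> F1 t != 0 by move=> tr; apply: F1_neq0; lra.
have ne2 t : rnorm t <= r -> F2 t != 0 by move=> tr; apply: F2_neq0; lra.
have [a1 [a1N a1P]] := odd_angle c2 F1N ne1 P1.
have [a2 [a2N a2P]] := odd_angle c2 F2N ne2 P2.
have near s t := angles_near rT c6 a1P a2P (s := s) (t := t).
(* Adding the relations at [(s, t)] and [(t, s)] eliminates [a2] by oddness. *)
have a1D s t : rnorm s + rnorm t <= r -> `|a1 (s + t) - a1 s - a1 t| <= 3 * e.
  move=> st; have := near s t st; have := near t s; rewrite addrC => /(_ st).
  rewrite [t + s]addrC -(opprB s t) a2N !ler_norml; lra.
(* Subtracting the relations at [(s, - t)] and [(- t, s)] eliminates [a1]. *)
have a2D s t : rnorm s + rnorm t <= r -> `|a2 (s + t) - a2 s - a2 t| <= 3 * e.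
  move=> st; have := near s (- t); have := near (- t) s.
  rewrite rnormN [_ + rnorm s]addrC => /(_ st) + /(_ st).
  rewrite [- t + s]addrC opprK -(opprD t s) (addrC t s) !a2N a1N !ler_norml; lra.
have shift F m (a : 'rV[R]_d -> R) : (forall t, a (- t) = - a t) ->
    (forall t, rnorm t <= r ->
      `|a t| <= c /\ F t = (cmod (F t))%:C%C * cexpi (a t + rdot m t)) ->
    (forall s t, rnorm s + rnorm t <= r ->
      `|a (s + t) - a s - a t| <= 3 * e) ->
    exists m', phase_near F m' r (12 * d%:R * e).
  (* [rdot u] interpolates [a] at the points [r e_k], so [approx_additive] applies to the difference
     with [k = 0]. *)
  move=> aN aP aD; pose u : 'rV[R]_d := \row_k (a (r *: delta_mx 0 k) / r).
  have er k : rnorm (r *: delta_mx 0 k : 'rV[R]_d) <= r.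
    by rewrite rnormZ rnorm_delta mulr1 gtr0_norm.
  exists (m + u) => t tr; exists (a t - rdot u t); last first.
    by rewrite rdotDl addrA [X in X + rdot u t]addrAC subrK; exact: (aP t tr).2.
  have -> : 12 * d%:R * e = d%:R * (2 * 0 + 4 * (3 * e)) by ring.
  apply: (approx_additive (r := r) (M := c + c) (a := fun t => a t - rdot u t)).
  - exact: ltW.
  - by move=> s; rewrite aN rdotNr opprD.
  - move=> s s' ss'; have := aD s s' ss'; rewrite rdotDr.
    by congr (`| _ | <= _); ring.
  - move=> k; rewrite rdotZr rdot_delta mxE mulrCA divff ?gt_eqF// mulr1 subrr.
    by rewrite normr0.
  - move=> s sr; apply: le_trans (ler_normB _ _) (lerD (aP s sr).1 _).
    apply: le_trans (norm_rdot_le (c := c / r) s _) _.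
      move=> k; rewrite mxE normrM normfV (gtr0_norm r0) ler_pM2r ?invr_gt0//.
      exact: (aP _ (er k)).1.
    rewrite mulrAC ler_pdivrMr// ler_wpM2l//.
    by apply: le_trans (aP 0 _).1; rewrite ?rnorm0 ?normr_ge0 ?ltW.
  - exact: tr.
have [m1' ?] := shift F1 m1 a1 a1N a1P a1D.
have [m2' ?] := shift F2 m2 a2 a2N a2P a2D.
by exists m1', m2'.
Qed.

(** With [h = t / 2], the factorization at [(h, h)] reads [F1 t = z F1(h)^2 |F2(h)|^2], and at
    [(h, - h)] it reads [F2 t = z |F1(h)|^2 F2(h)^2]. Angles double, and [z] adds at most
    [2 * e]. *)
Lemma double_phase m1 m2 r c : 2 * r <= T ->
  phase_near F1 m1 r c -> phase_near F2 m2 r c ->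
  phase_near F1 m1 (2 * r) (2 * c + 2 * e) /\
  phase_near F2 m2 (2 * r) (2 * c + 2 * e).
Proof.
move=> rT P1 P2.
have halfE t : t = 2^-1 *: t + 2^-1 *: t.
  by rewrite -scalerDl -[LHS]scale1r; congr (_ *: _); lra.
have half t : rnorm t <= 2 * r -> rnorm (2^-1 *: t) <= r.
  by rewrite rnormZ gtr0_norm ?invr_gt0//; lra.
have e2 : e <= 1 / 2 by have := e_le10; lra.
have polarE F m t z x a : cmod (z - 1) <= e -> `|a| <= c -> 0 <= x ->
    F t = z * (x%:C%C * cexpi (2 * (a + rdot m (2^-1 *: t)))) ->
    exists2 a, `|a| <= 2 * c + 2 * e &
      F t = (cmod (F t))%:C%C * cexpi (a + rdot m t).
  move=> z1 ac x0 Ft; have [b be zE] := polar_near1 e2 z1.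
  exists (2 * a + b).
    by move: ac be; rewrite !ler_norml; lra.
  rewrite {2}Ft !cmodM cmod_cexpi mulr1 cmodR (ger0_norm x0) Ft {1}zE polarM.
  by congr (_ * cexpi _); rewrite rdotZr; field.
split=> t tr; have h := half t tr; have hT : rnorm (2^-1 *: t) <= T.
- by have := rnorm_ge0 (2^-1 *: t); lra.
- have [a ac Fa] := P1 _ h; have [z z1] := F_near hT hT.
  rewrite -halfE subrr F20 mulr1 => Ft.
  apply: (polarE F1 m1 t z (cmod (F1 (2^-1 *: t)) ^+ 2 *
    cmod (F2 (2^-1 *: t)) ^+ 2) a z1 ac).
    by rewrite mulr_ge0 ?sqr_ge0.
  have [b bc Fb] := P2 _ h.
  rewrite Ft {1 2}Fa {1 2}Fb polarJ !polarM; congr (_ * (_ %:C%C * cexpi _)); ring.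
- by have := rnorm_ge0 (2^-1 *: t); lra.
- have [a ac Fa] := P2 _ h.
  have hNT : rnorm (- (2^-1 *: t)) <= T by rewrite rnormN.
  have [z z1] := F_near hT hNT.
  rewrite subrr opprK -halfE F10 mul1r => Ft.
  apply: (polarE F2 m2 t z (cmod (F1 (2^-1 *: t)) ^+ 2 *
    cmod (F2 (2^-1 *: t)) ^+ 2) a z1 ac).
    by rewrite mulr_ge0 ?sqr_ge0.
  have [b bc Fb] := P1 _ h.
  rewrite Ft F1N F2N {1 2}Fa {1 2}Fb !polarJ !polarM opprK.
  congr (_ * (_ %:C%C * cexpi _)); ring.
Qed.

Lemma phases_near : 0 < T ->
  (exists2 r, 0 < r & forall t, rnorm t <= r ->
    cmod (F1 t - 1) <= e /\ cmod (F2 t - 1) <= e) ->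
  exists m1 m2, phase_near F1 m1 T (12 * d%:R * e) /\
                phase_near F2 m2 T (12 * d%:R * e).
Proof.
move=> T0 [r r0 rP].
pose P x := exists m1 m2, phase_near F1 m1 x (12 * d%:R * e) /\
                          phase_near F2 m2 x (12 * d%:R * e).
have Pr : P r.
  have base F : (forall t, rnorm t <= r -> cmod (F t - 1) <= e) ->
      phase_near F 0 r (12 * d%:R * e).
    move=> Fr t /Fr; have e2 : e <= 1 / 2 by have := e_le10; lra.
    move=> /(polar_near1 e2)[a ae Fa]; exists a; last by rewrite rdot0l addr0.
    by apply: le_trans ae _; have := d1; have := e0; nra.
  by exists 0, 0; split; apply: base => t /rP[].
have Pdouble x : 0 < x -> 2 * x <= T -> P x -> P (2 * x).
  move=> x0 xT [m1 [m2 [P1 P2]]]; have [P1' P2'] := double_phase xT P1 P2.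
  apply: recentre P1' P2' => //; first by rewrite mulr_gt0.
  (* The doubled error is [24 * d * e + 2 * e]; six times this is at most [156 * d * e <= 1]. *)
  by have := e_small_linear; have := d1; have := e0; nra.
have Pdown x y : x <= y -> P y -> P x.
  move=> xy [m1 [m2 [P1 P2]]]; exists m1, m2.
  by split=> t tx; [apply: P1|apply: P2]; exact: le_trans xy.
pose n := Num.truncn (T / r).
(* Because [T / r < n + 1 <= 2 ^ (n + 1)]. The induction below then climbs from this radius to [T]
   by doubling. *)
have nr : T / 2 ^+ n.+1 <= r.
  rewrite ler_pdivrMr ?exprn_gt0// mulrC -ler_pdivrMr//.
  apply: le_trans (ltW (truncnS_gt _)) _.
  by rewrite -natrX ler_nat ltnW// ltn_expl.
have : P (T / 2 ^+ n.+1) by exact: Pdown Pr.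
elim: n.+1 => [|k IH]; first by rewrite expr0 divr1.
move=> Pk; apply: IH.
have -> : T / 2 ^+ k = 2 * (T / 2 ^+ k.+1).
  by rewrite exprS; field; rewrite expf_neq0.
apply: Pdouble Pk; first by rewrite divr_gt0// exprn_gt0.
have -> : 2 * (T / 2 ^+ k.+1) = T / 2 ^+ k.
  by rewrite exprS; field; rewrite expf_neq0.
by rewrite ler_pdivrMr ?exprn_gt0// ler_peMr ?(ltW T0)// exprn_ege1// ler1n.
Qed.

Lemma log_modulus_near s t : rnorm s <= T -> rnorm t <= T ->
  `|ln (cmod (F1 (s + t))) + ln (cmod (F2 (s - t)))
    - ln (cmod (F1 s)) - ln (cmod (F2 s))
    - ln (cmod (F1 t)) - ln (cmod (F2 t))| <= 2 * e.
Proof.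
move=> sT tT; have [z z1 /(congr1 (@cmod R))] := F_near sT tT.
have pos F x : F x != 0 -> 0 < cmod (F x).
  by move=> Fx; rewrite lt_neqAle cmod_ge0 andbT eq_sym;
    apply: contra_neq Fx; exact: cmod0_eq0.
have := pos _ _ (F1_neq0 sT); have := pos _ _ (F2_neq0 sT).
have := pos _ _ (F1_neq0 tT); have := pos _ _ (F2_neq0 tT).
rewrite !cmodM cmodJ => f2t f1t f2s f1s.
have z1' : `|cmod z - 1| <= e.
  by apply: le_trans z1; rewrite -(@cmod1 R) cmod_sub_ge.
have z0 : 0 < cmod z.
  by move: z1'; rewrite ler_norml; have := e_le10; lra.
have G0 : 0 < cmod (F1 s) * cmod (F2 s) * (cmod (F1 t) * cmod (F2 t)).
  by rewrite !mulr_gt0.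
move=> h; have := mulr_gt0 z0 G0; rewrite -h => fp.
(* The points [s + t] and [s - t] may leave the ball of radius [T]; the values there are nonzero
   because their product is. *)
have f1p : 0 < cmod (F1 (s + t)).
  rewrite lt_neqAle cmod_ge0 andbT eq_sym; apply: contraTneq fp => ->.
  by rewrite mul0r ltxx.
have f2m : 0 < cmod (F2 (s - t)).
  rewrite lt_neqAle cmod_ge0 andbT eq_sym; apply: contraTneq fp => ->.
  by rewrite mulr0 ltxx.
move/(congr1 (@ln R)): h; rewrite !lnM ?posrE ?mulr_gt0// => h.
have e2 : e <= 1 / 2 by have := e_le10; lra.
have := norm_ln_le e2 z1'; congr (`| _ | <= _).
by rewrite h; ring.
Qed.

Lemma gaussian_near (p : R) : 0 < T -> 0 < p ->
  (exists2 r, 0 < r & forall t, rnorm t <= r ->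
    cmod (F1 t - 1) <= e /\ cmod (F2 t - 1) <= e) ->
  (forall t, cmod (F1 t) <= 1 /\ cmod (F2 t) <= 1) ->
  (forall t, rnorm t <= T -> p <= cmod (F1 t) /\ p <= cmod (F2 t)) ->
  exists (m1 m2 : d.-tuple R) (Q : 'M[R]_d), sym_psd Q /\
    forall t, rnorm t <= T / 2 ->
      cmod (F1 t - gauss_cf m1 Q (tuple_of_row t)) <=
        720 * d%:R ^+ 2 * (d%:R + 1) * e * cmod (gauss_cf m1 Q (tuple_of_row t)) /\
      cmod (F2 t - gauss_cf m2 Q (tuple_of_row t)) <=
        720 * d%:R ^+ 2 * (d%:R + 1) * e * cmod (gauss_cf m2 Q (tuple_of_row t)).
Proof.
move=> T0 p0 cont F_le1 F_ge.
have [m1 [m2 [P1 P2]]] := phases_near T0 cont.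
pose L1 t := ln (cmod (F1 t)); pose L2 t := ln (cmod (F2 t)).
have near s t := @log_modulus_near s t.
have L10 : L1 0 = 0 by rewrite /L1 F10 cmod1 ln1.
have L20 : L2 0 = 0 by rewrite /L2 F20 cmod1 ln1.
have L1N t : L1 (- t) = L1 t by rewrite /L1 F1N cmodJ.
have L2N t : L2 (- t) = L2 t by rewrite /L2 F2N cmodJ.
have LM F t : cmod (F t) <= 1 -> p <= cmod (F t) ->
    0 <= - ln (cmod (F t)) <= - ln p.
  move=> F1' Fp; rewrite oppr_ge0 ln_le0//= lerN2 ler_ln// posrE//.
  exact: lt_le_trans Fp.
pose u t := - (L1 t + L2 t) / 2.
(* The relations at [(h, h)] and [(h, - h)] with [h = t / 2] differ by [L1 t - L2 t], so the two
   log-moduli agree up to [4 * e]. This is why one common matrix serves both functions. *)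
have L_near t : rnorm t <= T -> `|L1 t + u t| <= 2 * e /\ `|L2 t + u t| <= 2 * e.
  move=> tT; pose h : 'rV[R]_d := 2^-1 *: t.
  have hT : rnorm h <= T.
    rewrite rnormZ gtr0_norm ?invr_gt0//; have := rnorm_ge0 t; lra.
  have hNT : rnorm (- h) <= T by rewrite rnormN.
  have ht : h + h = t.
    by rewrite -scalerDl -[RHS]scale1r; congr (_ *: _); lra.
  have := near h h hT hT; have := near h (- h) hT hNT.
  rewrite -/(L1 _) -/(L2 _) -/(L1 (h - h)) -/(L2 (h - - h)) -/(L1 h) -/(L2 h).
  rewrite -/(L1 (- h)) -/(L2 (- h)) -/(L1 (h + h)) -/(L2 (h - h)).
  rewrite L1N L2N subrr opprK ht L10 L20 /u !ler_norml; lra.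
have [Q0 [Q0s Q0u]] : exists Q, Q^T = Q /\ forall t, rnorm t <= T ->
    `|u t - bform Q t t| <= 24 * d%:R ^+ 2 * (2 * e).
  apply: (approx_quadratic (M := - ln p)) => //.
  - by rewrite /u L10 L20 addr0 oppr0 mul0r.
  - by move=> t; rewrite /u L1N L2N.
  - move=> t tT; have [p1 p2] := F_ge t tT; have [q1 q2] := F_le1 t.
    by have := LM _ _ q1 p1; have := LM _ _ q2 p2; rewrite /u /L1 /L2; lra.
  - move=> s t sT tT; have tNT : rnorm (- t) <= T by rewrite rnormN.
    (* Averaging the relations at [(s, t)] and [(s, - t)] gives the quadratic equation for [u]. *)
    have := near s t sT tT; have := near s (- t) sT tNT.
    rewrite -/(L1 (s - t)) -/(L2 (s - - t)) -/(L1 s) -/(L2 s).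
    rewrite -/(L1 (- t)) -/(L2 (- t)) -/(L1 (s + t)) -/(L2 (s - t)).
    by rewrite -/(L1 t) -/(L2 t) L1N L2N opprK /u !ler_norml; lra.
have u_ge0 t : rnorm t <= T -> 0 <= u t.
  move=> tT; have [p1 p2] := F_ge t tT; have [q1 q2] := F_le1 t.
  by have := LM _ _ q1 p1; have := LM _ _ q2 p2; rewrite /u /L1 /L2; lra.
have [Q [Qpsd Qu]] := approx_psd T0 Q0s u_ge0 Q0u.
have e' := ltW e0; pose D : R := d%:R.
have e180 : 180 * D ^+ 2 * (D + 1) * e <= 1 / 2.
  move: e_small; rewrite -/D; lra.
have bnd F m t : (rnorm t <= T / 2) -> p <= cmod (F t) ->
    `|ln (cmod (F t)) + u t| <= 2 * e -> phase_near F m T (12 * d%:R * e) ->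
    cmod (F t - gauss_cf (tuple_of_row m) Q (tuple_of_row t)) <=
      720 * d%:R ^+ 2 * (d%:R + 1) * e *
        cmod (gauss_cf (tuple_of_row m) Q (tuple_of_row t)).
  move=> tT2 Fp Fu Fm; have tT : rnorm t <= T by lra.
  have [a ad Fa] := Fm t tT; have := Qu t tT2.
  have F0 : 0 < cmod (F t) by exact: lt_le_trans Fp.
  have -> : gauss_cf (tuple_of_row m) Q (tuple_of_row t) =
      (expR (- (qform Q (tuple_of_row t) / 2)))%:C%C * cexpi (rdot m t).
    congr (_ * cexpi _); apply: eq_bigr => i _.
    by rewrite !tnth_mktuple.
  set q := qform _ _ => uq; set G := (X in cmod (_ - X)).
  set x := ln (cmod (F t)) + q / 2.
  (* The relative error is that of [F t / G], with log-modulus [x] and angle [a]. *)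
  have -> : F t - G = G * ((expR x)%:C%C * cexpi a - 1).
    rewrite mulrBr mulr1 polarM -expRD Fa; congr (_ %:C%C * cexpi _ - _).
      by rewrite /x addrC addrK lnK ?posrE.
    by rewrite addrC.
  rewrite cmodM mulrC ler_wpM2r ?cmod_ge0//.
  (* The contributions are [2 * e] from [L_near], [48 * D^2 * e * (1 + D / 4)] from the matrix and
     [12 * D * e] from the phase. *)
  have xa : `|x| + `|a| <= 180 * D ^+ 2 * (D + 1) * e.
    have : `|x| <= 2 * e + 24 * d%:R ^+ 2 * (2 * e) * (1 + d%:R / 4).
      by move: Fu uq; rewrite /x !ler_norml; lra.
    have : D * e <= D ^+ 2 * e.
      by rewrite ler_wpM2r// expr2 ler_peMr// -[0]/0 (le_trans ler01).
    have : e <= D * e by rewrite ler_peMl.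
    have : 0 <= D ^+ 3 * e by rewrite mulr_ge0// exprn_ge0// (le_trans ler01).
    by rewrite -/D exprS; lra.
  apply: le_trans (cmod_exp_sub1_le xa e180) _.
  have : 0 <= D ^+ 2 * (D + 1) * e.
    by rewrite !mulr_ge0 ?sqr_ge0 ?addr_ge0// (le_trans ler01).
  rewrite -/D; lra.
exists (tuple_of_row m1), (tuple_of_row m2), Q; split=> // t tT2.
have tT : rnorm t <= T by lra.
have [p1 p2] := F_ge t tT; have [u1 u2] := L_near t tT.
by split; apply: bnd.
Qed.

End ApproxFactorization.

(** * Characteristic functions *)

Section CharacteristicFunctions.
Context (R : realType) (dO : measure_display) (Omega : measurableType dO).
Variable P : probability Omega R.

Lemma bounded_integrable d (T : measurableType d) (Q : probability T R)
    (f : T -> R) (K : R) : measurable_fun setT f -> (forall x, `|f x| <= K) ->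
  Q.-integrable setT (EFin \o f).
Proof.
move=> mf fK; apply: measurable_bounded_integrable => //.
  by apply: le_lt_trans (probability_le1 Q measurableT) (ltry 1).
exists K; split; first exact: num_real.
by move=> M KM x _; exact: le_trans (ltW KM).
Qed.

Lemma measurable_dotv d (t : d.-tuple R) : measurable_fun setT (dotv t).
Proof.
by apply: measurable_sum => i; apply: measurable_funM => //; exact: measurable_tnth.
Qed.

Lemma measurable_cos_dotv d (t : d.-tuple R) :
  measurable_fun setT (fun x => cos (dotv t x)).
Proof.
apply: (measurableT_comp (f := @cos R)); last exact: measurable_dotv.
exact: (continuous_measurable_fun (@continuous_cos R)).
Qed.

Lemma measurable_sin_dotv d (t : d.-tuple R) :
  measurable_fun setT (fun x => sin (dotv t x)).
Proof.
apply: (measurableT_comp (f := @sin R)); last exact: measurable_dotv.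
exact: (continuous_measurable_fun (@continuous_sin R)).
Qed.

Lemma EexpiE (Y : Omega -> R) :
  Eexpi P Y = ((\int[P]_w cos (Y w))%R +i* (\int[P]_w sin (Y w))%R)%C.
Proof. by rewrite /Eexpi /Rintegral !unlock. Qed.

(** Independence says that the law of the pair and the product of the laws agree on rectangles,
    hence everywhere; Fubini then separates the integral. *)
Lemma indep_Rintegral d1 d2 (X1 : {RV P >-> d1.-tuple R})
    (X2 : {RV P >-> d2.-tuple R}) (g : d1.-tuple R -> R) (h : d2.-tuple R -> R) :
  indep_vec P X1 X2 ->
  measurable_fun setT g -> (forall x, `|g x| <= 1) ->
  measurable_fun setT h -> (forall x, `|h x| <= 1) ->
  (\int[P]_w (g (X1 w) * h (X2 w)) =
   (\int[P]_w g (X1 w)) * (\int[P]_w h (X2 w)))%R.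
Proof.
move=> ind mg g1 mh h1.
have mZ : measurable_fun setT (fun w => (X1 w, X2 w)).
  by apply: measurable_fun_pair; exact: measurable_funPT.
pose Z : {mfun Omega >-> (d1.-tuple R * d2.-tuple R)%type} :=
  MeasurableFun.Pack (MeasurableFun.Class (isMeasurableFun.Build _ _ _ _ _ mZ)).
pose mu1 := distribution P X1; pose mu2 := distribution P X2.
pose f (z : d1.-tuple R * d2.-tuple R) : \bar R := (g z.1 * h z.2)%:E.
have mf' : measurable_fun setT (fun z : d1.-tuple R * d2.-tuple R => g z.1 * h z.2).
  by apply: measurable_funM; apply: measurableT_comp.
have f1 z : `|g z.1 * h z.2| <= 1.
  by rewrite normrM -[leRHS]mul1r ler_pM.
have mf : measurable_fun setT f by exact: measurableT_comp.
have iP : P.-integrable setT (f \o Z).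
  apply: (bounded_integrable P (f := fun w => g (X1 w) * h (X2 w)) (K := 1)).
    by apply: measurable_funM; apply: measurableT_comp => //;
      exact: measurable_funPT.
  by move=> w; exact: (f1 (X1 w, X2 w)).
have law A : measurable A -> (mu1 \x mu2)%E A = distribution P Z A.
  by apply: product_measure_unique => B C mB mC; exact: ind.
have step1 : (\int[P]_w (f \o Z) w = \int[mu1 \x mu2]_z f z)%E.
  rewrite -(integral_distribution mf iP).
  by apply: eq_measure_integral => A mA _; symmetry; exact: law.
(* Integrability is transported from the law of the pair, which is a probability. *)
have iprod : (mu1 \x mu2)%E.-integrable setT f.
  apply/integrableP; split => //.
  rewrite (eq_measure_integral (distribution P Z)); last first.
    by move=> A mA _; exact: law.
  have /integrableP[_] : (distribution P Z).-integrable setT f.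
    exact: (bounded_integrable _ (K := 1)).
  by [].
have ig : mu1.-integrable setT (EFin \o g) by exact: (bounded_integrable _ mg g1).
have ih : mu2.-integrable setT (EFin \o h) by exact: (bounded_integrable _ mh h1).
have step2 : (\int[mu1 \x mu2]_z f z =
    (\int[mu1]_x g x)%R%:E * (\int[mu2]_y h y)%R%:E)%E.
  rewrite -(integral12_prod_meas1 iprod).
  rewrite /fubini_F.
  under eq_integral => x _.
    rewrite /f /=; under eq_integral => y _ do rewrite EFinM.
    rewrite integralZl//.
    over.
  have ihf := integrable_fin_num measurableT ih.
  have igf := integrable_fin_num measurableT ig.
  rewrite -[(\int[mu2]_y (h y)%:E)%E]fineK// integralZr// /Rintegral.
  by rewrite [X in _ = (X * _)%E]fineK.
have tr d3 (X : {RV P >-> d3.-tuple R}) (k : d3.-tuple R -> R) :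
    measurable_fun setT k -> (forall x, `|k x| <= 1) ->
    (\int[distribution P X]_x k x = \int[P]_w k (X w))%R.
  move=> mk k1; rewrite /Rintegral integral_distribution//.
    exact: measurableT_comp.
  apply: (bounded_integrable P (f := k \o X) (K := 1)) => [|w]; last exact: k1.
  by apply: measurableT_comp => //; exact: measurable_funPT.
rewrite {1}/Rintegral -[LHS]/(fine (\int[P]_w (f \o Z) w)%E) step1 step2 /=.
by rewrite /mu1 /mu2 !tr.
Qed.


Lemma Rintegral_probability_cst (c : R) : (\int[P]_w c)%R = c.
Proof.
have PT : fine (P setT) = 1 by rewrite (probability_setT P).
by rewrite Rintegral_cst// -[RHS]mulr1; congr (_ * _); exact: PT.
Qed.

Lemma integrable_cos_dotv d (X : {RV P >-> d.-tuple R}) t :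
  P.-integrable setT (EFin \o (fun w => cos (dotv t (X w)))).
Proof.
apply: (bounded_integrable P (K := 1)) => [|w]; last exact: cos_max.
by apply: (measurableT_comp (measurable_cos_dotv t)); exact: measurable_funPT.
Qed.

Lemma integrable_sin_dotv d (X : {RV P >-> d.-tuple R}) t :
  P.-integrable setT (EFin \o (fun w => sin (dotv t (X w)))).
Proof.
apply: (bounded_integrable P (K := 1)) => [|w]; last exact: sin_max.
by apply: (measurableT_comp (measurable_sin_dotv t)); exact: measurable_funPT.
Qed.

Lemma integrable_dotv2 d (X1 X2 : {RV P >-> d.-tuple R}) (a b : d.-tuple R)
    (g h : R -> R) : continuous g -> continuous h ->
  (forall x, `|g x| <= 1) -> (forall x, `|h x| <= 1) ->
  P.-integrable setT (EFin \o (fun w => g (dotv a (X1 w)) * h (dotv b (X2 w)))).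
Proof.
move=> cg ch g1 h1; apply: (bounded_integrable P (K := 1)) => [|w].
  apply: measurable_funM.
    apply: (measurableT_comp (continuous_measurable_fun cg)).
    by apply: (measurableT_comp (measurable_dotv a)); exact: measurable_funPT.
  apply: (measurableT_comp (continuous_measurable_fun ch)).
  by apply: (measurableT_comp (measurable_dotv b)); exact: measurable_funPT.
by rewrite normrM -[leRHS]mul1r ler_pM.
Qed.

(** Real and imaginary parts are expanded by the addition formulas and each product is split by
    independence. Separate frequencies [a] and [b] cover sum, difference and joint law at once. *)
Lemma charfun_indep d (X1 X2 : {RV P >-> d.-tuple R}) (a b : d.-tuple R) :
  indep_vec P X1 X2 ->
  Eexpi P (fun w => dotv a (X1 w) + dotv b (X2 w)) =
  charfun P X1 a * charfun P X2 b.
Proof.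
move=> ind; rewrite /charfun !EexpiE.
have ccos := @continuous_cos R; have csin := @continuous_sin R.
have ind' := indep_Rintegral ind.
have mc := @measurable_cos_dotv d; have ms := @measurable_sin_dotv d.
have ii := integrable_dotv2 X1 X2 a b.
apply/eqP; rewrite eq_complex /=; apply/andP; split; apply/eqP.
  under eq_Rintegral => w _ do rewrite cosD.
  rewrite RintegralB//; [|exact: ii (@cos_max R) (@cos_max R)|
                          exact: ii (@sin_max R) (@sin_max R)].
  rewrite (ind' _ _ (mc a) (fun=> cos_max _) (mc b) (fun=> cos_max _)).
  by rewrite (ind' _ _ (ms a) (fun=> sin_max _) (ms b) (fun=> sin_max _)).
under eq_Rintegral => w _ do rewrite sinD.
rewrite RintegralD//; [|exact: ii (@sin_max R) (@cos_max R)|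
                        exact: ii (@cos_max R) (@sin_max R)].
rewrite (ind' _ _ (ms a) (fun=> sin_max _) (mc b) (fun=> cos_max _)).
rewrite (ind' _ _ (mc a) (fun=> cos_max _) (ms b) (fun=> sin_max _)).
by rewrite addrC.
Qed.

(** * Elementary properties of characteristic functions and continuity at 0 *)

Lemma dotv0 d (x : d.-tuple R) : dotv (tuple_of_row 0) x = 0.
Proof. by apply: big1 => i _; rewrite tnth_mktuple mxE mul0r. Qed.

Lemma dotvN d (s : 'rV[R]_d) (x : d.-tuple R) :
  dotv (tuple_of_row (- s)) x = - dotv (tuple_of_row s) x.
Proof. by rewrite -sumrN; apply: eq_bigr => i _; rewrite !tnth_mktuple mxE mulNr. Qed.

Lemma dotv_addsub d (s t : 'rV[R]_d) (x y : d.-tuple R) :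
  dotv (tuple_of_row s) (vadd x y) + dotv (tuple_of_row t) (vsub x y) =
  dotv (tuple_of_row (s + t)) x + dotv (tuple_of_row (s - t)) y.
Proof.
rewrite /dotv -!big_split; apply: eq_bigr => i _.
by rewrite /= !tnth_mktuple !mxE; ring.
Qed.

Lemma charfun0 d (X : Omega -> d.-tuple R) : charfun P X (tuple_of_row 0) = 1.
Proof.
rewrite /charfun EexpiE; under eq_Rintegral => w _ do rewrite dotv0 cos0.
under [X in (_ +i* X)%C]eq_Rintegral => w _ do rewrite dotv0 sin0.
by rewrite !Rintegral_probability_cst.
Qed.

Lemma charfunN d (X : {RV P >-> d.-tuple R}) (s : 'rV[R]_d) :
  charfun P X (tuple_of_row (- s)) = (charfun P X (tuple_of_row s))^*%C.
Proof.
rewrite /charfun !EexpiE /=; congr (_ +i* _)%C.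
  by apply: eq_Rintegral => w _; rewrite dotvN cosN.
under eq_Rintegral => w _ do rewrite dotvN sinN -mulN1r.
by rewrite RintegralZl ?mulN1r//; exact: integrable_sin_dotv.
Qed.

(** With [a] and [b] the means of cosine and sine, integrating
    [a cos + b sin <= (1 + a^2 + b^2) / 2] yields [a^2 + b^2 <= 1]. *)
Lemma cmod_charfun_le1 d (X : {RV P >-> d.-tuple R}) t : cmod (charfun P X t) <= 1.
Proof.
rewrite /charfun EexpiE; set a := (\int[P]_w cos _)%R; set b := (\int[P]_w sin _)%R.
have ic := integrable_cos_dotv X t; have is_ := integrable_sin_dotv X t.
have icZ r : P.-integrable setT (EFin \o (fun w => r * cos (dotv t (X w)))).
  by have := integrableZl measurableT r ic; apply: eq_integrable.
have isZ r : P.-integrable setT (EFin \o (fun w => r * sin (dotv t (X w)))).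
  by have := integrableZl measurableT r is_; apply: eq_integrable.
have : (\int[P]_w (a * cos (dotv t (X w)) + b * sin (dotv t (X w))) <=
    \int[P]_w ((1 + a ^+ 2 + b ^+ 2) / 2))%R.
  apply: le_Rintegral => //.
  - have := integrableD measurableT (icZ a) (isZ b).
    by apply: eq_integrable.
  - apply: (bounded_integrable P (K := `|(1 + a ^+ 2 + b ^+ 2) / 2|)).
      exact: measurable_cst.
    by [].
  - move=> w _; have := cos2Dsin2 (dotv t (X w)).
    move: (cos _) (sin _) => x y xy.
    have := sqr_ge0 (x - a); have := sqr_ge0 (y - b); rewrite !sqrrB; lra.
rewrite Rintegral_probability_cst RintegralD// !RintegralZl// -/a -/b => h.
rewrite /cmod /= -[leRHS]sqrtr1 ler_sqrt//; lra.
Qed.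

Lemma norm_dotv_le d (t x : d.-tuple R) : `|dotv t x| <= l1norm t * l1norm x.
Proof.
apply: le_trans (ler_norm_sum _ _ _) _; rewrite mulr_suml; apply: ler_sum => i _.
by rewrite normrM ler_wpM2l// /l1norm (bigD1 i)//= lerDl sumr_ge0.
Qed.

Lemma measurable_l1norm d : measurable_fun setT (@l1norm R d).
Proof.
apply: measurable_sum => i; apply: measurableT_comp => //.
exact: measurable_tnth.
Qed.

(** Dominated convergence; the truncation at 1 supplies the dominating function, since
    [l1norm (X w)] may fail to be integrable. *)
Lemma min_l1norm_small d (X : {RV P >-> d.-tuple R}) e : 0 < e ->
  exists n : nat,
    (\int[P]_w Num.min 1%R (l1norm (X w) / n.+1%:R) <= e)%R.
Proof.
move=> e0; pose f (n : nat) w : R := Num.min 1%R (l1norm (X w) / n.+1%:R).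
have l0 w : 0 <= l1norm (X w) by exact: sumr_ge0.
have f0 n w : 0 <= f n w by rewrite le_min ler01 divr_ge0.
have mf n : measurable_fun setT (f n).
  apply: measurable_minr => //; apply: measurable_funM => //.
  by apply: (measurableT_comp (@measurable_l1norm d)); exact: measurable_funPT.
have f_cvg w : (fun n => f n w) @ \oo --> (0 : R).
  apply: (@squeeze_cvgr _ _ _ _ (cst 0) (fun n => l1norm (X w) * n.+1%:R^-1)).
  - by near=> n; rewrite f0 /= ge_min lexx orbT.
  - exact: cvg_cst.
  - rewrite -[X in _ --> X](mulr0 (l1norm (X w))); apply: cvgMr.
    exact: cvg_harmonic.
have [] := @dominated_convergence _ _ _ P setT measurableT
  (fun n w => (f n w)%:E) (cst 0%E) (cst 1%E) _ _ _ _ _.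
- by move=> n; exact: measurableT_comp.
- exact: measurable_cst.
- by apply: aeW => w _; apply: cvg_EFin; [near=> n|exact: f_cvg].
- apply: (bounded_integrable P (f := cst 1) (K := 1)) => [|w].
    exact: measurable_cst.
  by rewrite normr1.
- apply: aeW => w n _ /=; rewrite lee_fin ger0_norm// /f ge_min lexx//.
move=> _ _; rewrite integral0 => /fine_cvgP[_ /cvgrPdist_le/(_ e e0)].
move=> [n _ /(_ n (leqnn n))]; rewrite /= sub0r normrN => h.
by exists n; apply: le_trans h; exact: ler_norm.
Unshelve. all: by end_near.
Qed.

(** For [l1norm t <= 1 / (n + 1)] the truncated norm [f] controls the integrands: [2 * f] for the
    cosine and [f] for the sine, hence the choice of [e / 3]. *)
Lemma charfun_cvg1 d (X : {RV P >-> d.-tuple R}) e : 0 < e ->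
  exists2 r, 0 < r & forall t, l1norm t <= r -> cmod (charfun P X t - 1) <= e.
Proof.
move=> e0; have e3 : 0 < e / 3 by rewrite divr_gt0.
have [n hn] := min_l1norm_small X e3.
exists n.+1%:R^-1 => [|t tn]; first by rewrite invr_gt0.
have l0 w : 0 <= l1norm (X w) by exact: sumr_ge0.
pose f w : R := Num.min 1%R (l1norm (X w) / n.+1%:R).
have f0 w : 0 <= f w by rewrite le_min ler01 divr_ge0.
have if_ : P.-integrable setT (EFin \o f).
  apply: (bounded_integrable P (K := 1)) => [|w].
    apply: measurable_minr => //; apply: measurable_funM => //.
    by apply: (measurableT_comp (@measurable_l1norm d)); exact: measurable_funPT.
  by rewrite ger0_norm// ge_min lexx.
have i1 : P.-integrable setT (EFin \o (cst 1 : Omega -> R)).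
  by apply: (bounded_integrable P (K := 1)) => // w; rewrite normr1.
have i2f : P.-integrable setT (EFin \o (fun w => 2 * f w)).
  by have := integrableZl measurableT 2 if_; apply: eq_integrable.
have dl w : `|dotv t (X w)| <= l1norm (X w) / n.+1%:R.
  by apply: le_trans (norm_dotv_le _ _) _; rewrite mulrC ler_wpM2l.
have cos_near w : `|cos (dotv t (X w)) - 1| <= 2 * f w.
  have c2 := cos_max (dotv t (X w)).
  have h := le_trans (cmod_Re _) (cmod_cexpi_sub1_le (dotv t (X w))).
  have h' : `|cos (dotv t (X w)) - 1| <= l1norm (X w) / n.+1%:R.
    exact: le_trans h (dl w).
  rewrite /f; case: (lerP 1 (l1norm (X w) / n.+1%:R)) => q.
    by move: c2; rewrite !ler_norml; lra.
  have : 0 <= l1norm (X w) / n.+1%:R by rewrite divr_ge0.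
  by move: (l1norm (X w) / n.+1%:R) h' {q} => y *; lra.
have sin_near w : `|sin (dotv t (X w))| <= f w.
  by rewrite le_min sin_max (le_trans (norm_sin_le _)).
have ic := integrable_cos_dotv X t; have is_ := integrable_sin_dotv X t.
have ic1 : P.-integrable setT (EFin \o (fun w => cos (dotv t (X w)) - 1)).
  by have := integrableB measurableT ic i1; apply: eq_integrable.
have Re_le : `|(\int[P]_w cos (dotv t (X w)))%R - 1| <= 2 * (e / 3).
  have -> : (\int[P]_w cos (dotv t (X w)))%R - 1 =
      (\int[P]_w (cos (dotv t (X w)) - 1))%R.
    by rewrite RintegralB// Rintegral_probability_cst.
  apply: le_trans (le_normr_Rintegral _ _) _ => //.
  apply: le_trans (_ : (\int[P]_w (2 * f w) <= _)%R); last first.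
    by rewrite RintegralZl// ler_wpM2l.
  apply: le_Rintegral => //; first exact: integrable_norm.
have Im_le : `|(\int[P]_w sin (dotv t (X w)))%R| <= e / 3.
  apply: le_trans (le_normr_Rintegral _ _) _ => //.
  apply: le_trans hn; apply: le_Rintegral => //; first exact: integrable_norm.
  by move=> w _; exact: sin_near.
rewrite /charfun EexpiE; set a := (\int[P]_w _)%R; set b := (\int[P]_w _)%R.
have -> : (a +i* b)%C - 1 = (a - 1)%:C%C + (0 +i* b)%C.
  by apply/eqP; rewrite eq_complex /= subr0 add0r addr0 !eqxx.
apply: le_trans (cmodD _ _) _; rewrite cmodR.
have -> : cmod (0 +i* b)%C = `|b| by rewrite /cmod /= expr0n add0r sqrtr_sqr.
by move: Re_le Im_le; rewrite -/a -/b; lra.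
Qed.

End CharacteristicFunctions.

(** * From sum and difference to the factorization, and the Gaussian approximation *)

Lemma rnormE (R : realType) d (s : 'rV[R]_d) : rnorm s = l1norm (tuple_of_row s).
Proof. by apply: eq_bigr => i _; rewrite tnth_mktuple. Qed.

Lemma dotv_vadd (R : realType) d (t x y : d.-tuple R) :
  dotv t (vadd x y) = dotv t x + dotv t y.
Proof.
by rewrite /dotv -big_split; apply: eq_bigr => i _; rewrite tnth_mktuple mulrDr.
Qed.

Lemma dotv_vsub (R : realType) d (s : 'rV[R]_d) (x y : d.-tuple R) :
  dotv (tuple_of_row s) (vsub x y) =
  dotv (tuple_of_row s) x + dotv (tuple_of_row (- s)) y.
Proof.
rewrite /dotv -big_split; apply: eq_bigr => i _.
by rewrite /= !tnth_mktuple mxE; ring.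
Qed.

Lemma sum_diff_factorization (R : realType) (dT : measure_display)
    (Omega : measurableType dT) (P : probability Omega R) (d : nat) (T eps : R)
    (X1 X2 : {RV P >-> d.-tuple R}) (s t : 'rV[R]_d) :
  indep_vec P X1 X2 ->
  eps_T_dependent P (fun w => vadd (X1 w) (X2 w)) (fun w => vsub (X1 w) (X2 w))
    eps T ->
  rnorm s <= T -> rnorm t <= T ->
  cmod (charfun P X1 (tuple_of_row (s + t)) * charfun P X2 (tuple_of_row (s - t))
    - charfun P X1 (tuple_of_row s) * charfun P X2 (tuple_of_row s)
      * (charfun P X1 (tuple_of_row t) * (charfun P X2 (tuple_of_row t))^*%C))
  <= eps.
Proof.
move=> ind dep; rewrite !rnormE => sT tT; have := dep _ _ sT tT.
have -> : charfun P (fun w => vadd (X1 w) (X2 w)) (tuple_of_row s) =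
    charfun P X1 (tuple_of_row s) * charfun P X2 (tuple_of_row s).
  by rewrite -charfun_indep//; congr (Eexpi P _); apply/funext => w; exact: dotv_vadd.
have -> : charfun P (fun w => vsub (X1 w) (X2 w)) (tuple_of_row t) =
    charfun P X1 (tuple_of_row t) * (charfun P X2 (tuple_of_row t))^*%C.
  rewrite -charfunN -charfun_indep//; congr (Eexpi P _).
  by apply/funext => w; exact: dotv_vsub.
congr (cmod (_ - _) <= _); rewrite -charfun_indep//; congr (Eexpi P _).
by apply/funext => w; exact: dotv_addsub.
Qed.

Theorem theorem2 (R : realType) (dT : measure_display) (Omega : measurableType dT)
  (P : probability Omega R) (d : nat) (T eps p : R)
  (X1 X2 : {RV P >-> d.-tuple R}) :
  (0 < d)%N -> 0 < T ->
  indep_vec P X1 X2 ->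
  eps_T_dependent P (fun w => vadd (X1 w) (X2 w)) (fun w => vsub (X1 w) (X2 w))
    eps T ->
  0 < p ->
  (forall t : d.-tuple R, l1norm t <= T ->
     p <= cmod (charfun P X1 t) /\ p <= cmod (charfun P X2 t)) ->
  0 < eps -> eps <= p ^+ 4 / (360 * d%:R ^+ 2 * (d%:R + 1)) ->
  exists (m1 m2 : d.-tuple R) (Q : 'M[R]_d),
    sym_psd Q /\
    forall t : d.-tuple R, l1norm t <= T / 2 ->
      cmod (charfun P X1 t - gauss_cf m1 Q t)
        <= (720 * d%:R ^+ 2 * (d%:R + 1)) / p ^+ 4 * eps * cmod (gauss_cf m1 Q t) /\
      cmod (charfun P X2 t - gauss_cf m2 Q t)
        <= (720 * d%:R ^+ 2 * (d%:R + 1)) / p ^+ 4 * eps * cmod (gauss_cf m2 Q t).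
Proof.
move=> d0 T0 ind dep p0 fp eps0 epsle.
pose F1 (s : 'rV[R]_d) := charfun P X1 (tuple_of_row s).
pose F2 (s : 'rV[R]_d) := charfun P X2 (tuple_of_row s).
have p40 : 0 < p ^+ 4 by rewrite exprn_gt0.
(* The relative error; the bound on [eps] becomes [e_small]. *)
pose e := eps / p ^+ 4.
have e0 : 0 < e by rewrite divr_gt0.
have e_small : 360 * d%:R ^+ 2 * (d%:R + 1) * e <= 1.
  rewrite /e mulrA ler_pdivrMr// mul1r mulrC -ler_pdivlMr//.
  by rewrite !mulr_gt0 ?exprn_gt0 ?ltr0n// ltr_wpDl.
have F_ge s : rnorm s <= T -> p <= cmod (F1 s) /\ p <= cmod (F2 s).
  by rewrite rnormE => /fp.
have neq0 z : p <= cmod z -> z != 0.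
  by apply: contraTneq => ->; rewrite /cmod Normc.normc0 -ltNge.
have F1_neq0 s : rnorm s <= T -> F1 s != 0 by move=> /F_ge[/neq0].
have F2_neq0 s : rnorm s <= T -> F2 s != 0 by move=> /F_ge[_ /neq0].
have F_near s t : rnorm s <= T -> rnorm t <= T -> exists2 z, cmod (z - 1) <= e &
    F1 (s + t) * F2 (s - t) = z * (F1 s * F2 s * (F1 t * (F2 t)^*%C)).
  move=> sT tT; have := sum_diff_factorization ind dep sT tT.
  rewrite -/(F1 s) -/(F1 t) -/(F1 (s + t)) -/(F2 s) -/(F2 t) -/(F2 (s - t)).
  set A := F1 (s + t) * _; set G := F1 s * _ * _ => AG.
  (* Each of the four factors of [G] has modulus at least [p], so dividing by [G] turns the absolute
     error [eps] into the relative error [e]. *)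
  have G_ge : p ^+ 4 <= cmod G.
    have [s1 s2] := F_ge _ sT; have [t1 t2] := F_ge _ tT.
    rewrite /G !cmodM cmodJ (_ : p ^+ 4 = p * p * (p * p)); last by ring.
    by rewrite !ler_pM ?mulr_ge0// ltW.
  have G0 : G != 0.
    apply: contraTneq G_ge => ->.
    by rewrite /cmod Normc.normc0 -ltNge.
  exists (A / G); last by rewrite divfK.
  have -> : A / G - 1 = (A - G) / G by rewrite mulrBl divff.
  rewrite cmodM cmodV ler_pdivrMr ?(lt_le_trans p40)//.
  apply: le_trans AG _; rewrite -[leLHS](divfK (lt0r_neq0 p40)) -/e.
  by rewrite ler_wpM2l// ltW.
have cvg : exists2 r, 0 < r & forall s, rnorm s <= r ->
    cmod (F1 s - 1) <= e /\ cmod (F2 s - 1) <= e.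
  have [r1 r10 h1] := charfun_cvg1 X1 e0; have [r2 r20 h2] := charfun_cvg1 X2 e0.
  exists (Num.min r1 r2); first by rewrite lt_min r10.
  by move=> s; rewrite rnormE le_min => /andP[/h1 ? /h2 ?].
have F_le1 s : cmod (F1 s) <= 1 /\ cmod (F2 s) <= 1.
  by split; exact: cmod_charfun_le1.
have [m1 [m2 [Q [Qpsd mQ]]]] := gaussian_near d0 e0 e_small
  (charfun0 P X1) (charfun0 P X2) (@charfunN _ _ _ P _ X1) (@charfunN _ _ _ P _ X2)
  F1_neq0 F2_neq0 F_near T0 p0 cvg F_le1 F_ge.
exists m1, m2, Q; split => // t tT.
have := mQ (row_of_tuple t); rewrite rnormE row_of_tupleK => /(_ tT).
rewrite /F1 /F2 ?row_of_tupleK.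
have -> : 720 * d%:R ^+ 2 * (d%:R + 1) / p ^+ 4 * eps =
  720 * d%:R ^+ 2 * (d%:R + 1) * e by rewrite /e; ring.
by [].
Qed.
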